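(* Let $p\in(1,\infty)$. Let $\mathcal{H}=\Delta_p+V$ be a positive quasilinear Schrödinger operator associated to a connected graph $b$ over $(X,m)$ with potential $V\le 1$. Let $\tilde{\mathcal{H}}$ be a critical quasilinear Schrödinger operator (with the same $p$) with Agmon ground state $v>0$, associated to a connected graph $\tilde b$ over $(X,m)$. Let $G_1$ be the minimal positive Green function of $\Delta_p+1$ (with $\Delta_p=\Delta_{p,b,m}$) at a fixed vertex $o\in X$. Let $u$ be an $\mathcal{H}$-harmonic function with non-trivial positive part $u_+=u\vee 0\neq 0$ such that for some constant $C>0$ and all $(x,y)\in\{u>0\}\times\{u>0\}$ $$b(x,y)^{2/p}\,u_+(x)u_+(y)\le C\,\tilde b(x,y)^{2/p}\,v(x)v(y),$$ $$b(x,y)^{1-2/p}\,|u_+(x)-u_+(y)|^{p-2}\le C\,\tilde b(x,y)^{1-2/p}\,|v(x)-v(y)|^{p-2},$$ and $$\liminf_{x\to\infty}\frac{u_+(x)}{G_1(x)}=0.$$ Then $u$ is trivially zero, i.e. $u=0$ on $X$ (since $u_+\ne0$ is assumed, this means that no such $u$ exists).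
   Context: $X$ is an infinite countable set with the discrete topology; compact subsets are the finite subsets, and $x\to\infty$ means leaving every finite subset of $X$ (so $\liminf_{x\to\infty}f(x)=\sup_{K\text{ finite}}\inf_{X\setminus K}f$). $C(X)$ is the set of real functions on $X$, $C_c(X)$ the finitely supported ones. $m:X\to(0,\infty)$ is a strictly positive function (measure of full support). A graph $b$ over $(X,m)$ is a symmetric function $b:X\times X\to[0,\infty)$ with zero diagonal and $\sum_{y}b(x,y)<\infty$ for all $x$; write $x\sim y$ if $b(x,y)>0$; $b$ is connected if any two vertices are joined by a finite path $x=x_0\sim\dots\sim x_n=y$. A function $f$ is called positive if $f\ge0$ and $f\ne0$; strictly positive, $f>0$, if $f(x)>0$ for all $x$. For $p\in(1,\infty)$, $a\in\mathbb{R}$, $r>0$ let $a^{\langle r\rangle}=a|a|^{r-1}$ if $a\neq0$ and $0^{\langle r\rangle}=0$. Let $\mathcal F_b(X)=\{f\in C(X):\sum_{y}b(x,y)|f(x)-f(y)|^{p-1}<\infty\text{ for all }x\}$. For $f\in\mathcal F_b(X)$, $$\Delta_p[f](x)=\Delta_{p,b,m}[f](x)=\frac1{m(x)}\sum_{y}b(x,y)(f(x)-f(y))^{\langle p-1\rangle},\qquad \mathcal H[f](x)=\Delta_p[f](x)+V(x)\,f(x)^{\langle p-1\rangle},$$ where $V:X\to\mathbb{R}$ is the potential; $\mathcal H=\Delta_p+V$ is the quasilinear Schrödinger operator associated to $b,m,V$. In particular $(\Delta_p+\alpha)[f]=\Delta_p[f]+\alpha f^{\langle p-1\rangle}$. A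 function $f\in\mathcal F_b(X)$ is $\mathcal H$-superharmonic (subharmonic, harmonic) if $\mathcal H[f]\ge0$ ($\le0$, $=0$) on $X$. $\mathcal H$ is called positive ($\mathcal H\ge0$) if it admits a positive $\mathcal H$-superharmonic function. The associated energy functional is $$Q_{p,b,m,V}(\varphi)=\frac12\sum_{x,y}b(x,y)|\varphi(x)-\varphi(y)|^p+\sum_x m(x)V(x)|\varphi(x)|^p,\quad\varphi\in C_c(X);$$ $\mathcal H$ is positive iff $Q_{p,b,m,V}\ge0$ on $C_c(X)$. A positive operator $\mathcal H$ (equivalently its energy functional) is subcritical if there is a positive $W\in C(X)$ with $Q_{p,b,m,V-W}\ge0$ on $C_c(X)$, and critical otherwise. $\mathcal H$ is critical iff it has a unique (up to positive multiples) positive $\mathcal H$-superharmonic function; this function is then strictly positive and $\mathcal H$-harmonic, and is called an Agmon ground state. For $\alpha\ge0$ and $o\in X$, the minimal positive Green function $G_\alpha$ is the smallest positive function $\phi$ with $(\Delta_p+\alpha)\phi=1_o$, where $1_o$ is the characteristic function of $\{o\}$; $G_\alpha$ exists for all $\alpha>0$. Convention: $0$ raised to a negative power is $+\infty$, so for $1<p<2$ the second inequality in the claim is an inequality in $[0,\infty]$. *)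

(* Defs.v *)
From HB Require Import structures.
From mathcomp Require Import all_boot all_order all_algebra.
From mathcomp Require Import all_classical all_reals all_analysis.

Set Implicit Arguments.
Unset Strict Implicit.
Unset Printing Implicit Defensive.

Import Order.TTheory GRing.Theory Num.Theory.
Local Open Scope classical_set_scope.
Local Open Scope ring_scope.

(* [c_c phi]: phi is finitely supported, i.e. phi \in C_c(X). *)
Definition c_c (R : realType) (X : countType) (phi : X -> R) : Prop :=
  finite_set [set x | phi x != 0].

(* "Positive" means nonnegative and not identically zero. *)
Definition positive_fun (R : realType) (X : countType) (f : X -> R) : Prop :=
  (forall x, 0 <= f x) /\ f <> cst 0.

Definition strictly_positive_fun (R : realType) (X : countType)
    (f : X -> R) : Prop :=
  forall x, 0 < f x.

(* Limit inferior as x leaves every finite subset of X. *)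
Definition liminf_infty (R : realType) (X : countType) (f : X -> R) : \bar R :=
  ereal_sup [set ereal_inf [set (f x)%:E | x in ~` K]
            | K in [set K : set X | finite_set K]].

(* a ^ r for a >= 0, where 0 to a negative power is +oo; the library's powR
   sets this value to 0.  Note that 0 ^ 0 = 1. *)
Definition ext_pow (R : realType) (a r : R) : \bar R :=
  if (a == 0) && (r < 0) then +oo%E else (a `^ r)%:E.

(* a^<r> = a |a|^(r-1); the factor a makes it vanish at a = 0 for every r. *)
Definition signed_pow (R : realType) (a r : R) : R := a * `|a| `^ (r - 1).

Record is_graph (R : realType) (X : countType) (b : X -> X -> R) : Prop :=
  IsGraph {
    graph_ge0 : forall x y, 0 <= b x y;
    graph_sym : forall x y, b x y = b y x;
    graph_diag : forall x, b x x = 0;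
    graph_summable : forall x, (\esum_(y in [set: X]) (b x y)%:E < +oo)%E
  }.

Definition connected_graph (R : realType) (X : countType)
    (b : X -> X -> R) : Prop :=
  forall x y : X, exists2 s : seq X,
    path (fun z w => 0 < b z w) x s & last x s = y.

(* Unordered sum of a real family, as the sum of the positive parts minus the
   sum of the negative parts.  It is only used for absolutely summable
   families, for which both sums are finite. *)
Definition usum (R : realType) (X : countType) (f : X -> R) : R :=
  fine (\esum_(y in [set: X]) (f^\+ y)%:E)
  - fine (\esum_(y in [set: X]) (f^\- y)%:E).

(* The space F_b(X), the domain of the p-Laplacian. *)
Definition formal_domain (R : realType) (X : countType) (p : R)
    (b : X -> X -> R) (f : X -> R) : Prop :=
  forall x,
    (\esum_(y in [set: X]) (b x y * `|f x - f y| `^ (p - 1))%:E < +oo)%E.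

Definition p_laplacian (R : realType) (X : countType) (p : R)
    (b : X -> X -> R) (m : X -> R) (f : X -> R) (x : X) : R :=
  (m x)^-1 * usum (fun y => b x y * signed_pow (f x - f y) (p - 1)).

(* The operator H = Delta_p + V; it is meaningful on [formal_domain p b]. *)
Definition schrodinger (R : realType) (X : countType) (p : R)
    (b : X -> X -> R) (m V : X -> R) (f : X -> R) (x : X) : R :=
  p_laplacian p b m f x + V x * signed_pow (f x) (p - 1).

Definition schrodinger_superharmonic (R : realType) (X : countType) (p : R)
    (b : X -> X -> R) (m V : X -> R) (f : X -> R) : Prop :=
  formal_domain p b f /\ forall x, 0 <= schrodinger p b m V f x.

Definition schrodinger_harmonic (R : realType) (X : countType) (p : R)
    (b : X -> X -> R) (m V : X -> R) (f : X -> R) : Prop :=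
  formal_domain p b f /\ forall x, schrodinger p b m V f x = 0.

Definition positive_operator (R : realType) (X : countType) (p : R)
    (b : X -> X -> R) (m V : X -> R) : Prop :=
  exists2 f : X -> R, positive_fun f & schrodinger_superharmonic p b m V f.

(* For phi in C_c(X) and p > 0 the potential term is a finite sum, since
   0 `^ p = 0. *)
Definition energy (R : realType) (X : countType) (p : R)
    (b : X -> X -> R) (m V : X -> R) (phi : X -> R) : \bar R :=
  ((2^-1)%:E * (\esum_(z in [set: X * X])
                  (b z.1 z.2 * `|phi z.1 - phi z.2| `^ p)%:E)
   + (\sum_(x \in [set: X]) m x * V x * `|phi x| `^ p)%R%:E)%E.

Definition energy_ge0 (R : realType) (X : countType) (p : R)
    (b : X -> X -> R) (m V : X -> R) : Prop :=
  forall phi : X -> R, c_c phi -> (0 <= energy p b m V phi)%E.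

Definition subcritical (R : realType) (X : countType) (p : R)
    (b : X -> X -> R) (m V : X -> R) : Prop :=
  positive_operator p b m V /\
  exists2 W : X -> R, positive_fun W & energy_ge0 p b m (fun x => V x - W x).

Definition critical (R : realType) (X : countType) (p : R)
    (b : X -> X -> R) (m V : X -> R) : Prop :=
  positive_operator p b m V /\ ~ subcritical p b m V.

(* The unique, up to positive multiples, positive superharmonic function.
   That such a v is strictly positive and harmonic when the operator is
   critical is a theorem, not part of the definition. *)
Definition agmon_ground_state (R : realType) (X : countType) (p : R)
    (b : X -> X -> R) (m V : X -> R) (v : X -> R) : Prop :=
  [/\ positive_fun v, schrodinger_superharmonic p b m V v &
      forall w : X -> R, positive_fun w ->
        schrodinger_superharmonic p b m V w ->
        exists2 c : R, 0 < c & forall x, w x = c * v x].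

Definition is_green (R : realType) (X : countType) (p : R)
    (b : X -> X -> R) (m : X -> R) (alpha : R) (o : X) (g : X -> R) : Prop :=
  [/\ positive_fun g, formal_domain p b g &
      forall x, schrodinger p b m (cst alpha) g x = \1_[set o] x].

Definition minimal_green (R : realType) (X : countType) (p : R)
    (b : X -> X -> R) (m : X -> R) (alpha : R) (o : X) (g : X -> R) : Prop :=
  is_green p b m alpha o g /\
  forall h : X -> R, is_green p b m alpha o h -> forall x, g x <= h x.

(* Main.v *)
Require Import Defs.
From HB Require Import structures.
From mathcomp Require Import all_boot all_order all_algebra.
From mathcomp Require Import all_classical all_reals all_analysis.
From mathcomp Require Import ring lra.

Set Implicit Arguments.
Unset Strict Implicit.
Unset Printing Implicit Defensive.

Import Order.TTheory GRing.Theory Num.Theory.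
Local Open Scope classical_set_scope.
Local Open Scope ring_scope.

(** Testing H against u_+ f^p shows that the energy of u_+ f is at most half the
    sum of b times the Picone remainders of (u_+, f), because u_+ is
    subharmonic; for the ground state v the reverse inequality holds.  The
    Picone remainder is a Jensen gap of |.|^p and is comparable to
      u(x) u(y) (f(x) - f(y))^2
        max((u(x) u(y))^(1/2) |f(x) - f(y)|, |u(x) - u(y)| (f(x) + f(y)))^(p-2),
    so the two bounds on u_+ and v say precisely that the remainders of u_+ are
    dominated by those of v.  Criticality yields f_n -> 1 along which the
    remainders of v tend to 0, hence the energy of u_+ f_n = g (u_+ f_n / g)
    tends to 0 from above, for g > 0 any superharmonic function of H.  Then the
    remainders of (g, u_+ f_n / g) vanish in the limit, so u_+ / g is constant
    and u > 0.  Since V <= 1, u is a supersolution of Delta_p + 1; below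
    min(G_1, s u), with s = G_1(o) / u(o), there is a Green function, so that
    G_1 <= s u by minimality, which contradicts the vanishing lower limit. *)

(** * Signed powers and the Jensen gap of |.|^p *)

(** The remainder contains signed powers of increments, so two remainders cannot be compared term by
    term; the squared form with a maximum can, because products and gradients of [u] and [v] enter
    it separately. It is homogeneous of degree [p] in the two values of [u], so an edge weight [b]
    is absorbed by scaling these values by b^(1/p); this is where the exponents 2/p and 1 - 2/p come
    from. For p < 2 the exponent p - 2 is negative and the gradient bound reverses: it bounds the
    increments of [v] by those of [u]. On edges that leave {u > 0} nothing is assumed, but there the
    remainder of u_+ vanishes. Vertices may have infinitely many neighbours, so rearrangements and
    limits under a sum over neighbours go through summable majorants. *)

Lemma le_powR (R : realType) (r x y : R) :
  0 <= r -> 0 <= x -> x <= y -> x `^ r <= y `^ r.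
Proof.
by move=> r0 x0 xy; apply: ge0_ler_powR; rewrite ?nnegrE//; exact: le_trans xy.
Qed.

(** Young's inequality for [x * 1] with exponent [r] and its conjugate, multiplied by [r]; [r = 1]
    has no finite conjugate and is treated apart. *)
Lemma bernoulli_ge1 (R : realType) (r x : R) :
  1 <= r -> 0 <= x -> 1 + r * (x - 1) <= x `^ r.
Proof.
rewrite le_eqVlt => /orP[/eqP<- x0|r1 x0].
  by rewrite powRr1// mul1r addrC subrK.
have r0 : 0 < r by lra.
have q0 : 0 < 1 - r^-1 by rewrite subr_gt0 invf_lt1.
have := @conjugate_powR R x 1 r (1 - r^-1)^-1 x0 ler01 r0.
rewrite invr_gt0 q0 invrK powR1 mul1r mulr1 => /(_ isT).
have -> : r^-1 + (1 - r^-1) = 1 by ring.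
move=> /(_ erefl); rewrite -(ler_pM2l r0).
have -> : r * (x `^ r / r + (1 - r^-1)) = x `^ r + r - 1.
  by field; rewrite gt_eqF.
by move=> ?; lra.
Qed.

(** This is [bernoulli_ge1] with exponent 1/r at the point x^r. *)
Lemma bernoulli_le1 (R : realType) (r x : R) :
  0 < r -> r <= 1 -> 0 <= x -> x `^ r <= 1 + r * (x - 1).
Proof.
move=> r0 r1 x0.
have := @bernoulli_ge1 R r^-1 (x `^ r).
rewrite invf_ge1// => /(_ r1 (powR_ge0 _ _)).
rewrite -powRrM divff ?gt_eqF// powRr1// -(ler_pM2l r0).
have -> : r * (1 + r^-1 * (x `^ r - 1)) = r + x `^ r - 1.
  by field; rewrite gt_eqF.
by move=> ?; lra.
Qed.

Section SignedPower.
Variable R : realType.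
Implicit Types a b c p q : R.

Lemma ge0_signed_powE q a : 0 < q -> 0 <= a -> signed_pow a q = a `^ q.
Proof. by move=> q0 a0; rewrite /signed_pow ger0_norm// mulr_powRB1. Qed.

Lemma signed_powN q a : signed_pow (- a) q = - signed_pow a q.
Proof. by rewrite /signed_pow normrN mulNr. Qed.

Lemma signed_pow0 q : signed_pow 0 q = 0 :> R.
Proof. by rewrite /signed_pow mul0r. Qed.

Lemma norm_signed_pow q a : 0 < q -> `|signed_pow a q| = `|a| `^ q.
Proof.
move=> q0; rewrite /signed_pow normrM (ger0_norm (powR_ge0 _ _)).
by rewrite mulr_powRB1.
Qed.

Lemma mulr_signed_pow p a : 1 < p -> a * signed_pow a (p - 1) = `|a| `^ p.
Proof.
move=> p1; rewrite -(@mulr_powRB1 _ `|a| p)//; last lra.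
rewrite -(@mulr_powRB1 _ `|a| (p - 1))//; last lra.
by rewrite /signed_pow !mulrA -normrM ger0_norm// -expr2 sqr_ge0.
Qed.

Lemma signed_powM q c a : 0 < q -> 0 <= c ->
  signed_pow (c * a) q = c `^ q * signed_pow a q.
Proof.
move=> q0 c0; rewrite /signed_pow normrM powRM// ger0_norm//.
by rewrite -(@mulr_powRB1 _ c q)//; ring.
Qed.

Lemma signed_pow_ge0 q a : 0 <= a -> 0 <= signed_pow a q.
Proof. by move=> a0; rewrite mulr_ge0// powR_ge0. Qed.

Lemma signed_pow_le0 q a : a <= 0 -> signed_pow a q <= 0.
Proof. by move=> a0; rewrite mulr_le0_ge0// powR_ge0. Qed.

Lemma le_signed_pow q a b : 0 < q -> a <= b -> signed_pow a q <= signed_pow b q.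
Proof.
move=> q0 ab; have [a0|a0] := leP 0 a.
  rewrite !ge0_signed_powE// ?(le_trans a0)//; apply: le_powR => //; exact: ltW.
have [b0|b0] := leP 0 b.
  exact: le_trans (signed_pow_le0 _ (ltW a0)) (signed_pow_ge0 _ b0).
rewrite -(opprK a) -(opprK b) signed_powN (signed_powN _ (- b)) lerN2.
have {}a0 := ltW a0; have {}b0 := ltW b0.
rewrite !ge0_signed_powE ?oppr_ge0//.
by apply: le_powR; rewrite ?oppr_ge0 ?lerN2 ?(ltW q0).
Qed.

(** Convexity of |.|^p: Bernoulli at |b|/|a|, scaled by |a|^p, settles the moduli, and signs only
    lower the linear term. *)
Lemma norm_powR_tangent p a b : 1 < p ->
  `|a| `^ p + p * signed_pow a (p - 1) * (b - a) <= `|b| `^ p.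
Proof.
move=> p1; have [->|a0] := eqVneq a 0.
  by rewrite signed_pow0 normr0 powR0 ?gt_eqF//; [rewrite mulr0 mul0r addr0 powR_ge0|lra].
have na : 0 < `|a| by rewrite normr_gt0.
have := @bernoulli_ge1 R p (`|b| / `|a|) (ltW p1) (divr_ge0 (normr_ge0 _) (normr_ge0 _)).
rewrite -(ler_pM2l (powR_gt0 p na)) -powRM ?divr_ge0//.
have -> : `|a| * (`|b| / `|a|) = `|b| by field; rewrite gt_eqF.
apply: le_trans.
have -> : `|a| `^ p * (1 + p * (`|b| / `|a| - 1)) =
   `|a| `^ p + p * (`|a| `^ p / `|a| * `|b| - `|a| `^ p).
  by field; rewrite gt_eqF.
rewrite lerD2l -mulrA ler_pM2l; last lra.
rewrite mulrBr (mulrC _ a) mulr_signed_pow// lerD2r.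
rewrite -(@mulr_powRB1 _ `|a| p)//; last lra.
rewrite (mulrC `|a|) mulfK ?gt_eqF//.
by rewrite -norm_signed_pow ?subr_gt0// -normrM ler_norm.
Qed.

Definition jensen_gap p t a b : R :=
  (1 - t) * `|a| `^ p + t * `|b| `^ p - `|(1 - t) * a + t * b| `^ p.

Lemma jensen_gap_ge0 p t a b : 1 < p -> 0 <= t <= 1 -> 0 <= jensen_gap p t a b.
Proof.
move=> p1 /andP[t0 t1]; rewrite /jensen_gap; set x := (1 - t) * a + t * b.
have ha := norm_powR_tangent x a p1.
have hb := norm_powR_tangent x b p1.
have := lerD (ler_wpM2l (_ : 0 <= 1 - t) ha) (ler_wpM2l t0 hb).
rewrite subr_ge0 => /(_ t1); rewrite subr_ge0; apply: le_trans.
by rewrite le_eqVlt; apply/orP; left; apply/eqP; rewrite /x; ring.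
Qed.

Lemma jensen_gapC p t a b : jensen_gap p t a b = jensen_gap p (1 - t) b a.
Proof.
rewrite /jensen_gap; have -> : 1 - (1 - t) = t by ring.
by rewrite (addrC (t * b)) (addrC (t * `|b| `^ p)).
Qed.

(** The tangent at [a], evaluated at the mean, and the tangent at [b], evaluated at [a], give the
    bound with factor [t]; by symmetry it also holds with 1 - t. The smaller weight is at most 2 t
    (1 - t). *)
Lemma jensen_gap_le p t a b : 1 < p -> 0 <= t <= 1 ->
  jensen_gap p t a b <=
  2 * p * (t * (1 - t)) * ((signed_pow a (p - 1) - signed_pow b (p - 1)) * (a - b)).
Proof.
move=> p1 t01.
set k := (_ - _) * _.
have k0 : 0 <= k.
  have [ab|ab] := leP a b.
    by apply: mulr_le0; rewrite subr_le0 ?le_signed_pow// subr_gt0.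
  by apply: mulr_ge0; rewrite subr_ge0 ?le_signed_pow ?(ltW ab)// subr_gt0.
have key s c d : 0 <= s <= 1 -> jensen_gap p s c d <=
    s * p * ((signed_pow c (p - 1) - signed_pow d (p - 1)) * (c - d)).
  move=> /andP[s0 s1]; rewrite /jensen_gap.
  set x := (1 - s) * c + s * d.
  have h1 := norm_powR_tangent c x p1.
  have h2 := norm_powR_tangent d c p1.
  have {}h2 := ler_wpM2l s0 h2.
  have e : x - c = s * (d - c) by rewrite /x; ring.
  move: h1; rewrite e => h1; nra.
have [t2|t2] := leP t 2^-1.
  apply: (le_trans (key t a b t01)); rewrite -/k.
  case/andP: t01 => t0 t1.
  rewrite ler_wpM2r//.
  have : 0 <= t * p * (1 - 2 * t) by rewrite mulr_ge0 ?mulr_ge0//; lra.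
  lra.
have t01' : 0 <= 1 - t <= 1 by lra.
rewrite jensen_gapC; apply: (le_trans (key _ b a t01')).
have -> : (signed_pow b (p - 1) - signed_pow a (p - 1)) * (b - a) = k.
  by rewrite /k; ring.
case/andP: t01 => t0 t1.
rewrite ler_wpM2r//.
have : 0 <= (1 - t) * p * (2 * t - 1) by rewrite mulr_ge0 ?mulr_ge0//; lra.
lra.
Qed.

(** The gap is concave in the weight and vanishes at both ends: for t <= 1/2 the mean is an average
    of [a] and the midpoint with weight 2 t, and the gap of that pair is nonnegative. *)
Lemma jensen_gap_ge p (t a b : R) : 1 < p -> 0 <= t <= 1 ->
  2 * (t * (1 - t)) * jensen_gap p 2^-1 a b <= jensen_gap p t a b.
Proof.
move=> p1.
have half01 : (0 : R) <= 2^-1 <= (1 : R) by rewrite invr_ge0 ler0n invf_le1 ?ler1n ?ltr0n.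
have key s c d : 0 <= s <= 2^-1 ->
    2 * s * jensen_gap p 2^-1 c d <= jensen_gap p s c d.
  move=> /andP[s0 s1].
  have s01 : 0 <= 2 * s <= 1 by lra.
  have := @jensen_gap_ge0 p (2 * s) c ((1 - 2^-1) * c + 2^-1 * d) p1 s01.
  rewrite /jensen_gap; set m := (1 - 2^-1) * c + 2^-1 * d.
  have -> : (1 - 2 * s) * c + 2 * s * m = (1 - s) * c + s * d.
    by rewrite /m; field.
  lra.
have k0 := @jensen_gap_ge0 p 2^-1 a b p1 half01.
move=> /andP[t0 t1]; have [t2|t2] := leP t 2^-1.
  have /key : 0 <= t <= 2^-1 by rewrite t0.
  move=> /(_ a b); apply: le_trans; rewrite ler_wpM2r//.
  have : 0 <= t * t by rewrite mulr_ge0.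
  lra.
have /key : 0 <= 1 - t <= 2^-1 by apply/andP; split; lra.
move=> /(_ b a); rewrite -(@jensen_gapC _ t).
have -> : jensen_gap p 2^-1 b a = jensen_gap p 2^-1 a b.
  by rewrite jensen_gapC; congr jensen_gap; field.
apply: le_trans; rewrite ler_wpM2r//.
have : 0 <= (1 - t) * (1 - t) by apply: mulr_ge0; lra.
lra.
Qed.

End SignedPower.

(** * Two-sided bounds for the Jensen gap and the Picone remainder *)

Section JensenGap.
Variable R : realType.
Implicit Types a b c p q t : R.

(** In [2 + q] the 2 serves b < 0, where the left side is at most 2 and 1 - b > 1. For b >= 0,
    Bernoulli gives the factor [q] if q >= 1, and b <= b^q gives the factor 1 otherwise. *)
Lemma one_sub_signed_pow_le q b : 0 < q -> `|b| <= 1 ->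
  1 - signed_pow b q <= (2 + q) * (1 - b).
Proof.
move=> q0 b1; have := b1; rewrite ler_norml => /andP[bl bu].
have [b0|b0] := leP 0 b; last first.
  have : `|signed_pow b q| <= 1.
    have := le_powR (ltW q0) (normr_ge0 b) b1.
    by rewrite norm_signed_pow// powR1.
  by rewrite ler_norml => /andP[? ?]; nra.
rewrite ge0_signed_powE//.
have [q1|q1] := leP 1 q.
  by have := bernoulli_ge1 q1 b0; nra.
have : b <= b `^ q.
  move: b0; rewrite le_eqVlt => /predU1P[<-|b0]; first exact: powR_ge0.
  by apply: ger1_powR; rewrite ?b0 ?bu// ltW.
nra.
Qed.

Lemma powR_taylor2 p : 1 < p ->
  exists2 c : R, 0 < c & forall e : R, `|e| <= 1 ->
    1 + p * e + c * e ^+ 2 <= (1 + e) `^ p.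
Proof.
move=> p1; have [p2|p2] := leP 2 p.
  exists (p / 2); first lra.
  move=> e; rewrite ler_norml => /andP[el eu].
  have e1 : 0 <= 1 + e by lra.
  (* Bernoulli with exponent p/2 at (1 + e)^2 produces the quadratic term. *)
  have -> : p = 2%:R * (p / 2) by field.
  rewrite powRrM powR_mulrn//.
  apply: le_trans (bernoulli_ge1 _ (sqr_ge0 _)); last lra.
  by rewrite le_eqVlt; apply/orP; left; apply/eqP; field.
(* Multiplying by (1 + e)^(2-p) <= 1 + (2-p) e reduces the claim to c (1 + (2-p) e) <= 1 - p (2-p) =
   (p-1)^2, and the factor of [c] is at most 2. *)
exists ((p - 1) ^+ 2 / 2); first by rewrite divr_gt0// exprn_gt0// subr_gt0.
move=> e; rewrite ler_norml => /andP[el eu].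
have [->|e1] := eqVneq e (- 1).
  by apply: le_trans (powR_ge0 _ _); nra.
have {el}e0 : 0 < 1 + e.
  by rewrite -ltrBlDl sub0r lt_neqAle eq_sym e1.
have h : (1 + e) `^ (2 - p) <= 1 + (2 - p) * e.
  have := @bernoulli_le1 R (2 - p) (1 + e); rewrite [1 + e - 1]addrAC subrr add0r.
  by apply; [lra|lra|exact: ltW].
have h0 : 0 < 1 + (2 - p) * e by apply: lt_le_trans h; exact: powR_gt0.
rewrite -(ler_pM2r h0).
apply: (@le_trans _ _ ((1 + e) ^+ 2)).
  have : 0 <= (p - 1) ^+ 2 * e ^+ 2 * (2 - (1 + (2 - p) * e)).
    by apply: mulr_ge0; [rewrite mulr_ge0 ?sqr_ge0|nra].
  lra.
have -> : (1 + e) ^+ 2 = (1 + e) `^ p * (1 + e) `^ (2 - p).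
  rewrite -powRD; last by rewrite (gt_eqF e0) implybT.
  by rewrite (addrC p) subrK powR_mulrn// ltW.
by rewrite ler_pM2l// powR_gt0.
Qed.

Lemma jensen_gap_half_ge p : 1 < p ->
  exists2 c : R, 0 < c & forall b, `|b| <= 1 ->
    c * (1 - b) ^+ 2 <= jensen_gap p 2^-1 1 b.
Proof.
move=> p1; have [c c0 hc] := powR_taylor2 p1.
have h2 : 0 < 2^-1 `^ p by rewrite powR_gt0// invr_gt0.
have h2' : 2^-1 `^ p * (1 + p) <= 1.
  have := @bernoulli_ge1 R p 2 (ltW p1) (ler0n _ _).
  have -> : 1 + p * (2 - 1) = 1 + p by ring.
  rewrite -(ler_pM2l h2); move/le_trans; apply.
  by rewrite -powRM ?invr_ge0// mulVf// powR1.
(* For b < 0 the midpoint has modulus at most 1/2, so the gap is at least 1/2 - 2^(-p) >= 1/2 -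
   1/(1+p) = 4 c1; the 4 absorbs (1 - b)^2 <= 4. *)
pose c1 := (p - 1) / (2 * (1 + p)) / 4.
have c10 : 0 < c1 by rewrite !divr_gt0 ?mulr_gt0//; lra.
exists (Num.min c1 (2^-1 `^ p * c / 4)).
  by rewrite lt_min c10/= divr_gt0// mulr_gt0.
move=> b b1; have := b1; rewrite ler_norml => /andP[bl bu].
rewrite /jensen_gap normr1 powR1.
have [b0|b0] := leP 0 b; last first.
  apply: (@le_trans _ _ (c1 * (1 - b) ^+ 2)).
    by rewrite ler_wpM2r ?sqr_ge0// ge_min lexx.
  have h3 : `|(1 - 2^-1) * 1 + 2^-1 * b| `^ p <= 2^-1 `^ p.
    by apply: le_powR => //; [lra|rewrite ler_norml; lra].
  have h4 : c1 * (1 - b) ^+ 2 <= c1 * 4.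
    by rewrite ler_pM2l//; nra.
  have h5 : c1 * 4 <= 2^-1 - 2^-1 `^ p.
    have -> : c1 * 4 = 2^-1 - (1 + p)^-1.
      by rewrite /c1; field; lra.
    by rewrite lerD2l lerN2 -(ler_pM2r (_ : 0 < 1 + p)) ?mulVf//; lra.
  have := powR_ge0 `|b| p; lra.
apply: (@le_trans _ _ (2^-1 `^ p * c / 4 * (1 - b) ^+ 2)).
  by rewrite ler_wpM2r ?sqr_ge0// ge_min lexx orbT.
(* Centred at the mean, 1 = mu (1 + e) and b = mu (1 - e), so the linear terms of the two expansions
   cancel. *)
pose mu := (1 + b) / 2; pose e := (1 - b) / (1 + b).
have b2 : 0 < 1 + b by lra.
have e0 : 0 <= e by apply: divr_ge0; lra.
have e1 : e <= 1 by rewrite /e ler_pdivrMr//; lra.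
have mu0 : 0 < mu by rewrite divr_gt0.
have -> : (1 - 2^-1) * 1 + 2^-1 * b = mu by rewrite /mu; field.
have := hc e; have := hc (- e).
rewrite normrN ger0_norm// => /(_ e1) hm /(_ e1) hp.
have e1' : 1 = mu * (1 + e) by rewrite /mu /e; field; lra.
have eb : b = mu * (1 + - e) by rewrite /mu /e; field; lra.
have {e1'}-> : (1 - 2^-1) * 1 = 2^-1 * (mu * (1 + e)) `^ p.
  by rewrite -e1' powR1; field.
rewrite (ger0_norm b0) (ger0_norm (ltW mu0)) [X in _ + 2^-1 * X `^ p]eb.
rewrite (@powRM _ mu (1 + e)) ?(@powRM _ mu (1 - e)); try lra.
have hmu : 2^-1 `^ p <= mu `^ p by apply: le_powR; rewrite ?invr_ge0//; rewrite /mu; lra.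
have he : (1 - b) ^+ 2 <= 4 * e ^+ 2.
  have : (1 - b) <= 2 * e by rewrite /e mulrA ler_pdivlMr//; nra.
  have : 0 <= 1 - b by lra.
  nra.
have hce : 0 <= c * e ^+ 2 by rewrite mulr_ge0 ?sqr_ge0// ltW.
apply: (@le_trans _ _ (mu `^ p * (c * e ^+ 2))).
  apply: (@le_trans _ _ (2^-1 `^ p * (c * e ^+ 2))); last by rewrite ler_wpM2r.
  rewrite -!mulrA ler_pM2l// ler_pM2l//; lra.
have := ler_wpM2l (powR_ge0 mu p) (lerD hm hp).
rewrite sqrrN; lra.
Qed.

Lemma jensen_gapM p t k a b : jensen_gap p t (k * a) (k * b) = `|k| `^ p * jensen_gap p t a b.
Proof.
rewrite /jensen_gap.
have -> : (1 - t) * (k * a) + t * (k * b) = k * ((1 - t) * a + t * b) by ring.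
by rewrite !normrM !powRM//; ring.
Qed.

(** By homogeneity the endpoint of larger modulus is scaled to 1. For a = b = 0 everything vanishes,
    whatever the power of 0. *)
Lemma jensen_gap_bounds p : 1 < p ->
  exists c C : R, [/\ 0 < c, 0 < C & forall t a b, 0 <= t <= 1 ->
    let S := t * (1 - t) * (a - b) ^+ 2 * Num.max `|a| `|b| `^ (p - 2) in
    c * S <= jensen_gap p t a b <= C * S].
Proof.
move=> p1; have [c c0 hc] := jensen_gap_half_ge p1.
exists (2 * c), (2 * p * (2 + (p - 1))); split.
- by rewrite mulr_gt0.
- by rewrite !mulr_gt0//; lra.
have main t a b : 0 <= t <= 1 -> `|b| <= `|a| ->
    2 * c * (t * (1 - t) * (a - b) ^+ 2 * `|a| `^ (p - 2)) <= jensen_gap p t a b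
      <= 2 * p * (2 + (p - 1)) * (t * (1 - t) * (a - b) ^+ 2 * `|a| `^ (p - 2)).
  move=> t01 ba.
  have [a0|a0] := eqVneq a 0.
    move: ba; rewrite a0 normr0 normr_le0 => /eqP->.
    rewrite /jensen_gap !mulr0 addr0 subrr normr0 (@powR0 _ p); last by rewrite gt_eqF//; lra.
    by rewrite !mulr0 addr0 subr0 expr0n/= !(mulr0, mul0r, lexx).
  have na : 0 < `|a| by rewrite normr_gt0.
  pose be := b / a.
  have eb : b = a * be by rewrite /be mulrC divfK.
  have be1 : `|be| <= 1 by rewrite /be normrM normfV ler_pdivrMr// mul1r.
  have eS : (a - b) ^+ 2 * `|a| `^ (p - 2) = `|a| `^ p * (1 - be) ^+ 2.
    have -> : `|a| `^ p = `|a| ^+ 2 * `|a| `^ (p - 2).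
      rewrite -powR_mulrn// -powRD; last by rewrite (gt_eqF na) implybT.
      by congr (_ `^ _); ring.
    by rewrite real_normK ?num_real// eb; ring.
  have -> : jensen_gap p t a b = `|a| `^ p * jensen_gap p t 1 be.
    by rewrite -jensen_gapM mulr1 -eb.
  have tt : 0 <= t * (1 - t) by case/andP: t01 => t0 t1; rewrite mulr_ge0// subr_ge0.
  have ap : 0 < `|a| `^ p by exact: powR_gt0.
  rewrite -(mulrA (t * _)) eS; apply/andP; split.
    have -> : 2 * c * (t * (1 - t) * (`|a| `^ p * (1 - be) ^+ 2)) =
      `|a| `^ p * (2 * (t * (1 - t)) * (c * (1 - be) ^+ 2)) by ring.
    rewrite ler_pM2l//; apply: le_trans (jensen_gap_ge _ _ p1 t01).
    by apply: ler_wpM2l; [rewrite mulr_ge0|exact: hc].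
  have -> : 2 * p * (2 + (p - 1)) * (t * (1 - t) * (`|a| `^ p * (1 - be) ^+ 2)) =
      `|a| `^ p * (2 * p * (t * (1 - t)) * ((2 + (p - 1)) * (1 - be) * (1 - be))) by ring.
  rewrite ler_pM2l//; apply: le_trans (jensen_gap_le _ _ p1 t01) _.
  rewrite ler_wpM2l//; first by rewrite !mulr_ge0//; lra.
  have be2 : 0 <= 1 - be by move: be1; rewrite ler_norml; lra.
  rewrite ler_wpM2r// (ge0_signed_powE _ ler01) ?powR1; last lra.
  by apply: one_sub_signed_pow_le => //; lra.
move=> t a b t01 /=; have [ba|ab] := leP `|b| `|a|; first exact: main.
rewrite jensen_gapC -(sqrrN (a - b)) opprB (mulrC t).
have := @main (1 - t) b a; have -> : 1 - (1 - t) = t by ring.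
by apply; [lra|exact: ltW].
Qed.

(** Comparability is asked in both directions because a negative power reverses the order. *)
Lemma le_powR_comparable (r K x y : R) : 0 < x -> 0 < y -> 1 <= K ->
  x <= K * y -> y <= K * x -> x `^ r <= K `^ `|r| * y `^ r.
Proof.
move=> x0 y0 K1 xy yx; have K0 : 0 <= K by lra.
have [r0|r0] := leP 0 r.
  rewrite ger0_norm// -powRM ?(ltW y0)//; apply: le_powR => //; exact: ltW.
have nr : 0 <= - r by lra.
rewrite ltr0_norm// -{1 3}(opprK r) !(powRN _ (- r)).
rewrite -(ler_pM2r (powR_gt0 (- r) x0)) mulVf ?gt_eqF ?powR_gt0//.
rewrite mulrAC -powRM ?(ltW x0)// ler_pdivlMr ?powR_gt0// mul1r.
by apply: le_powR => //; exact: ltW.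
Qed.

(* The remainder in Picone's inequality for the functions u and u f on an edge
   whose endpoints are labelled 1 and 2. *)
Definition picone p (u1 u2 f1 f2 : R) : R :=
  `|u1 * f1 - u2 * f2| `^ p -
  signed_pow (u1 - u2) (p - 1) * (u1 * f1 `^ p - u2 * f2 `^ p).

(* The edge term of the simplified energy, with the usual sum of the two
   competing slopes replaced by their maximum. *)
Definition simplified p (u1 u2 f1 f2 : R) : R :=
  u1 * u2 * (f1 - f2) ^+ 2 *
  Num.max (Num.sqrt (u1 * u2) * `|f1 - f2|) (`|u1 - u2| * (f1 + f2)) `^ (p - 2).

Lemma piconeC p (u1 u2 f1 f2 : R) : picone p u1 u2 f1 f2 = picone p u2 u1 f2 f1.
Proof.
rewrite /picone -normrN opprB -(opprB u2 u1) signed_powN; ring.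
Qed.

Lemma simplifiedC p (u1 u2 f1 f2 : R) :
  simplified p u1 u2 f1 f2 = simplified p u2 u1 f2 f1.
Proof.
rewrite /simplified -(sqrrN (f1 - f2)) opprB (mulrC u1) (distrC f1).
by rewrite (distrC u1) (addrC f1).
Qed.

Lemma picone_diag p (u1 u2 f : R) : 1 < p -> 0 <= f -> picone p u1 u2 f f = 0.
Proof.
move=> p1 f0; rewrite /picone -!mulrBl normrM powRM// (ger0_norm f0) mulrA.
by rewrite (mulrC (signed_pow _ _)) mulr_signed_pow// subrr.
Qed.

(** For u2 < u1 put B = u1 - u2, t = u2/u1 and z = (u1 f1 - u2 f2)/B. Then (1-t) z + t f2 = f1, and
    the remainder is B^(p-1) u1 times the Jensen gap of z and f2. Its maximum, times B, is [N0],
    which is then compared with the symmetric maximum [N]. *)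
Lemma picone_bounds p : 1 < p ->
  exists c C : R, [/\ 0 < c, 0 < C & forall u1 u2 f1 f2,
    0 < u1 -> 0 < u2 -> 0 <= f1 -> 0 <= f2 ->
    c * simplified p u1 u2 f1 f2 <= picone p u1 u2 f1 f2
      <= C * simplified p u1 u2 f1 f2].
Proof.
move=> p1; have [c [C [c0 C0 hcC]]] := jensen_gap_bounds p1.
pose K : R := 4 `^ `|p - 2|.
have K0 : 0 < K by rewrite powR_gt0.
pose c' := Num.min c 1 / K; pose C' := Num.max C 1 * K.
exists c', C'; split.
- by rewrite divr_gt0// lt_min c0 ltr01.
- by rewrite mulr_gt0// lt_max C0.
have main u1 u2 f1 f2 : 0 < u1 -> 0 < u2 -> u2 <= u1 -> 0 <= f1 -> 0 <= f2 ->
    c' * simplified p u1 u2 f1 f2 <= picone p u1 u2 f1 f2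
      <= C' * simplified p u1 u2 f1 f2; last first.
  move=> u1 u2 f1 f2 u10 u20 f10 f20.
  have [u21|u12] := leP u2 u1; first exact: main.
  rewrite piconeC simplifiedC; apply: main => //; exact: ltW.
move=> u10 u20 u21 f10 f20.
have [->|f12] := eqVneq f1 f2.
  by rewrite picone_diag// /simplified subrr expr0n/= mulr0 mul0r !mulr0 lexx.
pose N0 := Num.max `|u1 * f1 - u2 * f2| ((u1 - u2) * f2).
pose S0 := u1 * u2 * (f1 - f2) ^+ 2 * N0 `^ (p - 2).
have d0 : 0 < `|f1 - f2| by rewrite normr_gt0 subr_eq0.
(* The minimum and maximum with 1 cover u1 = u2, where z is undefined and the remainder is exactly
   [S0]. *)
have S0b : Num.min c 1 * S0 <= picone p u1 u2 f1 f2 <= Num.max C 1 * S0.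
  have S00 : 0 <= S0.
    by rewrite mulr_ge0 ?powR_ge0// mulr_ge0 ?sqr_ge0// mulr_ge0 ?(ltW u10) ?(ltW u20).
  have [u12|u12] := eqVneq u1 u2.
    have -> : picone p u1 u2 f1 f2 = S0.
      rewrite /picone /S0 /N0 -u12 subrr signed_pow0 !mul0r subr0 -mulrBr.
      have ud : 0 < `|u1 * (f1 - f2)| by rewrite normr_gt0 mulf_neq0 ?subr_eq0// gt_eqF.
      rewrite max_l//.
      have -> : u1 * u1 * (f1 - f2) ^+ 2 = `|u1 * (f1 - f2)| ^+ 2.
        by rewrite real_normK ?num_real// exprMn expr2.
      rewrite -powR_mulrn// -powRD; last by rewrite (gt_eqF ud) implybT.
      by congr (_ `^ _); ring.
    apply/andP; split.
      by rewrite -[leRHS]mul1r ler_wpM2r// ge_min lexx orbT.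
    by rewrite -[leLHS]mul1r ler_wpM2r// le_max lexx orbT.
  have B0 : 0 < u1 - u2 by rewrite subr_gt0 lt_neqAle eq_sym u12.
  pose B := u1 - u2; pose z := (u1 * f1 - u2 * f2) / B; pose t := u2 / u1.
  have ez : u1 * f1 - u2 * f2 = B * z by rewrite /z [RHS]mulrC divfK// gt_eqF.
  have t01 : 0 <= t <= 1 by rewrite /t divr_ge0 ?(ltW u10) ?(ltW u20)//= ler_pdivrMr// mul1r.
  have eBp : B `^ p = B * B `^ (p - 1) by rewrite mulr_powRB1 ?(ltW B0)//; lra.
  have eBp1 : B `^ (p - 1) = B * B `^ (p - 2).
    have -> : p - 2 = p - 1 - 1 by ring.
    by rewrite mulr_powRB1 ?(ltW B0)//; lra.
  have eP : picone p u1 u2 f1 f2 = B `^ (p - 1) * u1 * jensen_gap p t z f2.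
    have -> : jensen_gap p t z f2 = B / u1 * `|z| `^ p + u2 / u1 * f2 `^ p - f1 `^ p.
      rewrite /jensen_gap (ger0_norm f20).
      have -> : 1 - t = B / u1 by rewrite /t /B; field; rewrite gt_eqF.
      have -> : B / u1 * z + t * f2 = f1.
        have -> : B / u1 * z = (u1 * f1 - u2 * f2) / u1 by rewrite ez; ring.
        by rewrite /t; field; rewrite gt_eqF.
      by rewrite (ger0_norm f10).
    rewrite /picone ez normrM powRM// (ger0_norm (ltW B0)) eBp.
    rewrite ge0_signed_powE ?(ltW B0)//; last lra.
    by rewrite -/B; field; rewrite gt_eqF.
  have eS : S0 = B `^ (p - 1) * u1 *
      (t * (1 - t) * (z - f2) ^+ 2 * Num.max `|z| `|f2| `^ (p - 2)).
    rewrite /S0; have -> : N0 = B * Num.max `|z| `|f2|.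
      rewrite /N0 maxr_pMr ?(ltW B0)// ez normrM (ger0_norm (ltW B0)).
      by rewrite (ger0_norm f20).
    rewrite powRM ?(ltW B0) ?le_max ?normr_ge0// eBp1.
    have -> : z - f2 = u1 * (f1 - f2) / B.
      by rewrite /z /B; field; rewrite gt_eqF.
    have -> : 1 - t = B / u1 by rewrite /t /B; field; rewrite gt_eqF.
    by rewrite /t; field; rewrite (gt_eqF u10) (gt_eqF B0).
  have /andP[lb ub] := hcC t z f2 t01.
  have k0 : 0 < B `^ (p - 1) * u1 by rewrite mulr_gt0// powR_gt0.
  rewrite eP; apply/andP; split.
    apply: (@le_trans _ _ (c * S0)); first by rewrite ler_wpM2r// ge_min lexx.
    by rewrite eS mulrCA ler_pM2l.
  apply: (@le_trans _ _ (C * S0)); last by rewrite ler_wpM2r// le_max lexx.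
  by rewrite eS mulrCA ler_pM2l.
set N := Num.max (Num.sqrt (u1 * u2) * `|f1 - f2|) (`|u1 - u2| * (f1 + f2)).
have uu : 0 < u1 * u2 by rewrite mulr_gt0.
have B0 : 0 <= u1 - u2 by rewrite subr_ge0.
have sq0 : 0 < Num.sqrt (u1 * u2) by rewrite sqrtr_gt0.
have sq2 := sqr_sqrtr (ltW uu).
have sqle : Num.sqrt (u1 * u2) <= u1.
  by rewrite -(@ler_pXn2r _ 2)// ?nnegrE ?(ltW sq0) ?(ltW u10)// sq2 expr2 ler_pM2l.
have N00 : 0 <= N0 by rewrite le_max normr_ge0.
have hud : u1 * `|f1 - f2| <= 2 * N0.
  have -> : u1 * `|f1 - f2| = `|(u1 * f1 - u2 * f2) - (u1 - u2) * f2|.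
    rewrite -{1}(ger0_norm (ltW u10)) -normrM; congr `|_|; ring.
  apply: le_trans (ler_normB _ _) _.
  have : `|u1 * f1 - u2 * f2| <= N0 by rewrite le_max lexx.
  have : `|(u1 - u2) * f2| <= N0.
    by rewrite normrM (ger0_norm B0) (ger0_norm f20) le_max lexx orbT.
  lra.
have hb : (u1 - u2) * f2 <= N0 by rewrite le_max lexx orbT.
have Npos : 0 < N by rewrite lt_max mulr_gt0.
have NN0 : N <= 4 * N0.
  rewrite ge_max; apply/andP; split.
    apply: (@le_trans _ _ (u1 * `|f1 - f2|)); first by rewrite ler_pM2r.
    lra.
  rewrite (ger0_norm B0).
  have f1le : f1 <= f2 + `|f1 - f2| by have := ler_norm (f1 - f2); lra.
  have := ler_wpM2l B0 f1le.
  have : (u1 - u2) * `|f1 - f2| <= u1 * `|f1 - f2| by rewrite ler_pM2r//; lra.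
  lra.
have N0N : N0 <= 4 * N.
  have h1 : (u1 - u2) * (f1 + f2) <= N by rewrite le_max (ger0_norm B0) lexx orbT.
  have h2 : Num.sqrt (u1 * u2) * `|f1 - f2| <= N by rewrite le_max lexx.
  have h3 : u1 * `|f1 - f2| <= 2 * N.
    (* If u2 >= u1/4 then 2 sqrt(u1 u2) >= u1 and the first entry of [N] controls u1 |f1 - f2|;
       otherwise u1 - u2 is at least 3/4 of u1 and the second entry does. *)
    have [q|q] := leP (u1 / 4) u2.
      apply: (@le_trans _ _ (2 * (Num.sqrt (u1 * u2) * `|f1 - f2|))); last lra.
      rewrite mulrA ler_pM2r//.
      have s20 : 0 <= 2 * Num.sqrt (u1 * u2) by rewrite mulr_ge0// ltW.
      rewrite -(@ler_pXn2r _ 2)// ?nnegrE ?(ltW u10)//.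
      by rewrite exprMn sq2; nra.
    have dle : `|f1 - f2| <= f1 + f2 by rewrite ler_norml; lra.
    have := ler_wpM2l B0 dle.
    have : 0 <= (u1 - 4 * u2) * `|f1 - f2| by rewrite mulr_ge0//; lra.
    nra.
  have h4 : (u1 - u2) * f2 <= N by apply: le_trans h1; rewrite ler_wpM2l// lerDr.
  rewrite ge_max; apply/andP; split; last lra.
  have -> : u1 * f1 - u2 * f2 = u1 * (f1 - f2) + (u1 - u2) * f2 by ring.
  apply: le_trans (ler_normD _ _) _.
  rewrite !normrM (ger0_norm B0) (ger0_norm f20) (ger0_norm (ltW u10)); lra.
have N0pos : 0 < N0 by lra.
have k14 : 1 <= 4 :> R by rewrite ler1n.
have h1 := @le_powR_comparable (p - 2) 4 N N0 Npos N0pos k14 NN0 N0N.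
have h2 := @le_powR_comparable (p - 2) 4 N0 N N0pos Npos k14 N0N NN0.
rewrite -/K in h1 h2.
have k0 : 0 < u1 * u2 * (f1 - f2) ^+ 2.
  by rewrite mulr_gt0// exprn_even_gt0//= subr_eq0.
rewrite /simplified -/N; case/andP: S0b => lb ub; apply/andP; split.
  apply: le_trans lb; rewrite /c' -mulrA ler_pM2l; last by rewrite lt_min c0 ltr01.
  by rewrite ler_pdivrMl// /S0 (mulrCA K) ler_pM2l.
apply: (le_trans ub); rewrite /C' -mulrA ler_pM2l; last by rewrite lt_max C0.
by rewrite /S0 (mulrCA K) ler_pM2l.
Qed.

End JensenGap.

(** * Comparison of Picone remainders *)

Section PiconeComparison.
Variable R : realType.
Implicit Types p r : R.

Lemma simplified_ge0 p (u1 u2 f1 f2 : R) : 0 <= u1 -> 0 <= u2 ->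
  0 <= simplified p u1 u2 f1 f2.
Proof.
move=> u10 u20; rewrite /simplified mulr_ge0 ?powR_ge0//.
by rewrite mulr_ge0 ?sqr_ge0// mulr_ge0.
Qed.

Lemma simplifiedM p k (u1 u2 f1 f2 : R) : 0 < k ->
  simplified p (k * u1) (k * u2) f1 f2 = k `^ p * simplified p u1 u2 f1 f2.
Proof.
move=> k0; rewrite /simplified -mulrBr normrM (gtr0_norm k0).
have -> : k * u1 * (k * u2) = k ^+ 2 * (u1 * u2) by ring.
rewrite sqrtrM ?sqr_ge0// sqrtr_sqr (gtr0_norm k0) -!(mulrA k) -maxr_pMr ?(ltW k0)//.
rewrite powRM ?(ltW k0)//; last by rewrite le_max mulr_ge0// sqrtr_ge0.
have -> : k `^ p = k ^+ 2 * k `^ (p - 2).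
  rewrite -powR_mulrn ?(ltW k0)// -powRD; last by rewrite (gt_eqF k0) implybT.
  by congr (_ `^ _); ring.
ring.
Qed.

Lemma picone_ge0 p (u1 u2 f1 f2 : R) : 1 < p ->
  0 < u1 -> 0 < u2 -> 0 <= f1 -> 0 <= f2 -> 0 <= picone p u1 u2 f1 f2.
Proof.
move=> p1 u10 u20 f10 f20; have [c [C [c0 _ /(_ _ _ _ _ u10 u20 f10 f20)]]] := picone_bounds p1.
move=> /andP[+ _]; apply: le_trans.
by rewrite mulr_ge0 ?simplified_ge0// ltW.
Qed.

Lemma le_powR_root r (C x y : R) : 0 < r -> 0 <= C -> 0 <= x -> 0 <= y ->
  x `^ r <= C * y `^ r -> x <= C `^ r^-1 * y.
Proof.
move=> r0 C0 x0 y0 h.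
have := le_powR (_ : 0 <= r^-1) (powR_ge0 _ _) h.
rewrite invr_ge0 (ltW r0) powRM ?powR_ge0// -!powRrM divff ?gt_eqF//.
by rewrite !powRr1//; apply.
Qed.

(** A negative power reverses the order. The value [+oo] at 0 keeps this true for x = 0: the right
    side must then be infinite, so y = 0. *)
Lemma ext_pow_gradient (p C x y : R) : p < 2 -> 0 < C -> 0 <= x -> 0 <= y ->
  (ext_pow x (p - 2)%R <= C%:E * ext_pow y (p - 2)%R)%E ->
  y <= C `^ (2 - p)^-1 * x.
Proof.
move=> p2 C0; rewrite /ext_pow subr_lt0 p2 !andbT.
rewrite le_eqVlt => /predU1P[<-|x0].
  rewrite eqxx le_eqVlt => /predU1P[<-|y0]; first by rewrite mulr0.
  by rewrite (gt_eqF y0) -EFinM leye_eq.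
rewrite (gt_eqF x0) le_eqVlt => /predU1P[<- _|y0].
  by rewrite mulr_ge0 ?powR_ge0// ltW.
rewrite (gt_eqF y0) -EFinM lee_fin => h.
apply: le_powR_root; rewrite ?subr_gt0//; try exact: ltW.
move: h; rewrite -(opprB 2 p) !powRN.
rewrite -(ler_pM2r (powR_gt0 (2 - p) x0)) mulVf ?gt_eqF ?powR_gt0//.
by rewrite mulrAC ler_pdivlMr ?powR_gt0// mul1r.
Qed.

Lemma simplified_compare p C : 1 < p -> 0 < C ->
  exists2 K : R, 0 < K & forall u1 u2 v1 v2 f1 f2 : R,
    0 < u1 -> 0 < u2 -> 0 < v1 -> 0 < v2 -> 0 <= f1 -> 0 <= f2 ->
    u1 * u2 <= C * (v1 * v2) ->
    (ext_pow `|u1 - u2|%R (p - 2)%R <= C%:E * ext_pow `|v1 - v2|%R (p - 2)%R)%E ->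
    simplified p u1 u2 f1 f2 <= K * simplified p v1 v2 f1 f2.
Proof.
move=> p1 C0; have sC0 : 0 < Num.sqrt C by rewrite sqrtr_gt0.
have sqrtle (a a' : R) : a <= C * a' -> Num.sqrt a <= Num.sqrt C * Num.sqrt a'.
  by move=> h; rewrite -sqrtrM ?(ltW C0)//; exact: ler_wsqrtr.
have [p2|p2|<-] := ltgtP 2 p; last first.
- exists C => // u1 u2 v1 v2 f1 f2 _ _ _ _ _ _ h _.
  by rewrite /simplified subrr !powRr0 !mulr1 mulrA ler_wpM2r ?sqr_ge0.
- pose k := C `^ (2 - p)^-1; pose r := 2 - p.
  have k0 : 0 < k by rewrite powR_gt0.
  have r0 : 0 < r by rewrite subr_gt0.
  (* One summand for each entry that can realise the maximum [N']. *)
  pose K := Num.sqrt C `^ p + C * k `^ r.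
  have K0 : 0 < K by rewrite addr_gt0 ?mulr_gt0 ?powR_gt0.
  exists K => // u1 u2 v1 v2 f1 f2 u10 u20 v10 v20 f10 f20 hA.
  move=> /(ext_pow_gradient p2 C0 (normr_ge0 _) (normr_ge0 _)); rewrite -/k => hg.
  have [->|f12] := eqVneq f1 f2.
    by rewrite /simplified subrr expr0n/= !(mulr0, mul0r).
  have d0 : 0 < `|f1 - f2| by rewrite normr_gt0 subr_eq0.
  move: hg; rewrite /simplified; set A := u1 * u2 in hA *; set A' := v1 * v2 in hA *.
  set d := `|f1 - f2| in d0 *; set du := `|u1 - u2|; set dv := `|v1 - v2|.
  set g := f1 + f2 => hg.
  have g0 : 0 <= g by rewrite addr_ge0.
  have A0 : 0 < A by rewrite mulr_gt0.
  have A'0 : 0 < A' by rewrite mulr_gt0.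
  have sA0 : 0 < Num.sqrt A by rewrite sqrtr_gt0.
  have sA'0 : 0 < Num.sqrt A' by rewrite sqrtr_gt0.
  set N := Num.max (Num.sqrt A * d) _; set N' := Num.max (Num.sqrt A' * d) _.
  have N0 : 0 < N by rewrite lt_max mulr_gt0.
  have N'0 : 0 < N' by rewrite lt_max mulr_gt0.
  suff : A * N' `^ r <= K * A' * N `^ r.
    have -> : p - 2 = - r by rewrite opprB.
    rewrite !powRN => h.
    have {}h : A / N `^ r <= K * A' / N' `^ r.
      by rewrite ler_pdivrMr ?powR_gt0// mulrAC ler_pdivlMr ?powR_gt0.
    have := ler_wpM2r (sqr_ge0 (f1 - f2)) h; lra.
  have [e|e] : N' = Num.sqrt A' * d \/ N' = dv * g.
    by rewrite /N'; case: leP; [right|left].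
  + apply: (@le_trans _ _ (Num.sqrt C `^ p * A' * N `^ r)); last first.
      rewrite ler_wpM2r ?powR_ge0// ler_wpM2r ?(ltW A'0)// lerDl.
      by rewrite mulr_ge0 ?powR_ge0// ltW.
    (* Since p + r = 2, each product splits in this way; for [A] the r-th power comes from the first
       entry of [N], so that only p-th powers remain to be compared. *)
    have sq (a : R) : 0 < a -> a = Num.sqrt a `^ p * Num.sqrt a `^ r.
      move=> a0; rewrite -powRD; last by rewrite sqrtr_eq0 leNgt a0 implybT.
      have -> : p + r = 2%:R by rewrite /r; ring.
      by rewrite powR_mulrn ?sqrtr_ge0// sqr_sqrtr// ltW.
    rewrite e powRM ?(ltW d0) ?(ltW sA'0)//.
    apply: (@le_trans _ _ (Num.sqrt C `^ p * A' * (Num.sqrt A * d) `^ r)); last first.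
      apply: ler_wpM2l; first by rewrite mulr_ge0 ?powR_ge0// ltW.
      by apply: le_powR; [exact: ltW|rewrite mulr_ge0// ltW|rewrite le_max lexx].
    rewrite powRM ?(ltW d0) ?(ltW sA0)// {1}(sq _ A0) {2}(sq _ A'0).
    have h : Num.sqrt A `^ p <= Num.sqrt C `^ p * Num.sqrt A' `^ p.
      rewrite -powRM ?(ltW sC0) ?(ltW sA'0)//.
      by apply: le_powR; [lra|exact: ltW|exact: sqrtle].
    have := ler_wpM2r (_ : 0 <= Num.sqrt A `^ r * Num.sqrt A' `^ r * d `^ r) h.
    rewrite !mulr_ge0 ?powR_ge0// => /(_ isT); lra.
  + apply: (@le_trans _ _ (C * k `^ r * A' * N `^ r)); last first.
      rewrite ler_wpM2r ?powR_ge0// ler_wpM2r ?(ltW A'0)// lerDr.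
      exact: powR_ge0.
    have h : N' `^ r <= k `^ r * N `^ r.
      rewrite -powRM ?(ltW k0) ?(ltW N0)//; apply: le_powR; try exact: ltW.
      rewrite e; apply: (@le_trans _ _ (k * du * g)); first by rewrite ler_wpM2r.
      by rewrite -mulrA ler_pM2l// le_max lexx orbT.
    have := ler_pM (ltW A0) (powR_ge0 _ _) hA h; lra.
(* For p > 2 the power p - 2 is increasing, so each entry of [N] is bounded by [k] times the same
   entry of [N']. *)
pose k := Num.max (Num.sqrt C) (C `^ (p - 2)^-1).
have k0 : 0 < k by rewrite lt_max sC0.
exists (C * k `^ (p - 2)); first by rewrite mulr_gt0// powR_gt0.
move=> u1 u2 v1 v2 f1 f2 u10 u20 v10 v20 f10 f20 hA.
have ext (a : R) : ext_pow a (p - 2) = (a `^ (p - 2))%:E.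
  by rewrite /ext_pow ltNge subr_ge0 (ltW p2) andbF.
rewrite !ext -EFinM lee_fin.
move=> /(le_powR_root (_ : 0 < p - 2) (ltW C0) (normr_ge0 _) (normr_ge0 _)).
rewrite subr_gt0 p2 => /(_ isT) hg.
rewrite /simplified.
set N := Num.max _ _; set N' := Num.max (Num.sqrt (v1 * v2) * _) _.
have N0 : 0 <= N by rewrite le_max mulr_ge0// sqrtr_ge0.
have N'0 : 0 <= N' by rewrite le_max mulr_ge0// sqrtr_ge0.
have h : N `^ (p - 2) <= k `^ (p - 2) * N' `^ (p - 2).
  rewrite -powRM ?(ltW k0)//; apply: le_powR => //; first by rewrite subr_ge0 ltW.
  rewrite ge_max; apply/andP; split.
    apply: (@le_trans _ _ (k * (Num.sqrt (v1 * v2) * `|f1 - f2|))).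
      rewrite mulrA ler_wpM2r//; apply: le_trans (sqrtle _ _ hA) _.
      by rewrite ler_wpM2r ?sqrtr_ge0// le_max lexx.
    by rewrite ler_pM2l// le_max lexx.
  apply: (@le_trans _ _ (k * (`|v1 - v2| * (f1 + f2)))).
    rewrite mulrA ler_wpM2r ?addr_ge0//; apply: le_trans hg _.
    by rewrite ler_wpM2r// le_max lexx orbT.
  by rewrite ler_pM2l// le_max lexx orbT.
have A0 : 0 <= u1 * u2 * (f1 - f2) ^+ 2 by rewrite mulr_ge0 ?sqr_ge0// mulr_ge0// ltW.
have hA' : u1 * u2 * (f1 - f2) ^+ 2 <= C * (v1 * v2) * (f1 - f2) ^+ 2.
  by rewrite ler_wpM2r ?sqr_ge0.
have := ler_pM A0 (powR_ge0 _ _) hA' h; lra.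
Qed.

Lemma picone_compare p C : 1 < p -> 0 < C ->
  exists2 K : R, 0 < K & forall b b' u1 u2 v1 v2 f1 f2 : R,
    0 <= b -> 0 <= b' ->
    0 < u1 -> 0 < u2 -> 0 < v1 -> 0 < v2 -> 0 <= f1 -> 0 <= f2 ->
    b `^ (2 / p) * (u1 * u2) <= C * (b' `^ (2 / p) * (v1 * v2)) ->
    (ext_pow b (1 - 2 / p)%R * ext_pow `|u1 - u2|%R (p - 2)%R <=
      C%:E * (ext_pow b' (1 - 2 / p)%R * ext_pow `|v1 - v2|%R (p - 2)%R))%E ->
    b * picone p u1 u2 f1 f2 <= K * (b' * picone p v1 v2 f1 f2).
Proof.
move=> p1 C0; have [K K0 hK] := simplified_compare p1 C0.
have [c [c' [c0 c'0 hc]]] := picone_bounds p1.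
exists (c' * K / c); first by rewrite divr_gt0// mulr_gt0.
have p0 : 0 < p by lra.
move=> b b' u1 u2 v1 v2 f1 f2; rewrite le_eqVlt => /predU1P[<-|b0].
  move=> b'0 _ _ v10 v20 f10 f20 _ _; rewrite mul0r mulr_ge0//.
    by rewrite divr_ge0 ?mulr_ge0// ltW.
  by rewrite mulr_ge0// picone_ge0.
(* The case b > 0 = b' is excluded by the first bound, whose left side is positive. *)
rewrite le_eqVlt => /predU1P[<-|b'0] u10 u20 v10 v20 f10 f20.
  rewrite powR0; last by rewrite mulf_neq0 ?invr_eq0 ?gt_eqF.
  by rewrite mul0r mulr0 leNgt mulr_gt0// ?powR_gt0// mulr_gt0.
move=> h1 h2.
pose k := b `^ p^-1; pose k' := b' `^ p^-1.
have k0 : 0 < k by rewrite powR_gt0.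
have k'0 : 0 < k' by rewrite powR_gt0.
have ek (a : R) : 0 <= a -> (a `^ p^-1) `^ p = a.
  by move=> a0; rewrite -powRrM mulVf ?gt_eqF// powRr1.
have ek2 (a : R) : a `^ (2 / p) = (a `^ p^-1) ^+ 2.
  by rewrite -powR_mulrn ?powR_ge0// -powRrM mulrC.
have g1 : k * u1 * (k * u2) <= C * (k' * v1 * (k' * v2)).
  by move: h1; rewrite !ek2 -/k -/k'; lra.
have ext (a x y : R) : 0 < a -> 
   (ext_pow a (1 - 2 / p)%R * ext_pow `|x - y|%R (p - 2)%R)%E =
   ext_pow `|a `^ p^-1 * x - a `^ p^-1 * y|%R (p - 2)%R.
  move=> a0; rewrite -mulrBr normrM (gtr0_norm (powR_gt0 _ a0)) /ext_pow.
  rewrite (gt_eqF a0)/= mulf_eq0 (gt_eqF (powR_gt0 _ a0))/=.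
  case: ifPn => _; first by rewrite gt0_muley// lte_fin powR_gt0.
  rewrite -EFinM powRM ?powR_ge0// -powRrM; congr ((_ `^ _ * _)%:E).
  by field; rewrite gt_eqF.
rewrite !ext// -/k -/k' in h2.
have := hK _ _ _ _ f1 f2 (mulr_gt0 k0 u10) (mulr_gt0 k0 u20)
  (mulr_gt0 k'0 v10) (mulr_gt0 k'0 v20) f10 f20 g1 h2.
rewrite !simplifiedM// !ek ?(ltW b0) ?(ltW b'0)// => h.
have /andP[_ hu] := hc _ _ _ _ u10 u20 f10 f20.
have /andP[hv _] := hc _ _ _ _ v10 v20 f10 f20.
apply: (le_trans (ler_wpM2l (ltW b0) hu)).
rewrite mulrCA; apply: (le_trans (ler_wpM2l (ltW c'0) h)).
have t0 : 0 < c' * K / c * b' by rewrite mulr_gt0// divr_gt0// mulr_gt0.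
have := ler_wpM2l (ltW t0) hv.
have -> : c' * K / c * b' * (c * simplified p v1 v2 f1 f2) =
  c' * (K * (b' * simplified p v1 v2 f1 f2)) by field; rewrite gt_eqF.
by rewrite -(mulrA (c' * K / c)).
Qed.

(** A bound on [f1] alone is enough: if d = |f1 - f2| >= e, then f1 + f2 <= 2 L + d <= d (2 L / e +
    1), so the maximum divided by d lies in [s, k] and the simplified term is at least u1 u2 m
    d^p. *)
Lemma picone_coercive p (u1 u2 L e : R) : 1 < p -> 0 < u1 -> 0 < u2 ->
  0 <= L -> 0 < e ->
  exists2 d : R, 0 < d & forall f1 f2, 0 <= f1 <= L -> 0 <= f2 ->
    picone p u1 u2 f1 f2 < d -> `|f1 - f2| < e.
Proof.
move=> p1 u10 u20 L0 e0; have [c [C [c0 _ hc]]] := picone_bounds p1.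
have A0 : 0 < u1 * u2 by rewrite mulr_gt0.
have s0 : 0 < Num.sqrt (u1 * u2) by rewrite sqrtr_gt0.
set s := Num.sqrt _ in s0.
pose k := s + `|u1 - u2| * (2 * L / e + 1).
have k1 : 0 <= `|u1 - u2| * (2 * L / e + 1).
  by rewrite mulr_ge0// addr_ge0// divr_ge0 ?mulr_ge0// ltW.
have k0 : 0 < k by rewrite ltr_wpDr.
pose m := Num.min (s `^ (p - 2)) (k `^ (p - 2)).
have m0 : 0 < m by rewrite lt_min !powR_gt0.
exists (c * (u1 * u2 * m * e `^ p)).
  by rewrite !mulr_gt0// powR_gt0.
move=> f1 f2 /andP[f10 f1L] f20; apply: contraTT; rewrite -!leNgt => ed.
have /andP[+ _] := hc _ _ _ _ u10 u20 f10 f20; apply: le_trans.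
rewrite ler_pM2l// /simplified.
set d := `|f1 - f2| in ed *; have d0 : 0 < d by exact: lt_le_trans ed.
set N := Num.max _ _.
pose n := N / d.
have eN : N = n * d by rewrite /n divfK// gt_eqF.
have sn : s <= n by rewrite ler_pdivlMr// le_max lexx.
have n0 : 0 < n by exact: lt_le_trans sn.
have nk : n <= k.
  rewrite ler_pdivrMr// ge_max; apply/andP; split.
    by rewrite ler_pM2r// lerDl.
  rewrite /k mulrDl -[leLHS]add0r; apply: lerD; first by rewrite mulr_ge0// ltW.
  rewrite -(mulrA `|u1 - u2|) ler_wpM2l//.
  have h1 : f2 <= f1 + d by have := ler_norm (f2 - f1); rewrite distrC -/d; lra.
  have h2 : 2 * L <= 2 * L / e * d.
    by rewrite mulrAC ler_pdivlMr// ler_wpM2l// mulr_ge0.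
  lra.
have hm : m <= n `^ (p - 2).
  rewrite ge_min; have [p2|p2] := leP 2 p.
    by rewrite le_powR ?subr_ge0// ltW.
  apply/orP; right.
  have -> : p - 2 = - (2 - p) by ring.
  rewrite !(powRN _ (2 - p)) lef_pV2 ?posrE ?powR_gt0//.
  by apply: le_powR; [lra|exact: ltW|].
have -> : N `^ (p - 2) = n `^ (p - 2) * d `^ (p - 2).
  by rewrite eN powRM ?ltW.
have -> : u1 * u2 * (f1 - f2) ^+ 2 * (n `^ (p - 2) * d `^ (p - 2)) =
   u1 * u2 * (n `^ (p - 2) * d `^ p).
  have -> : d `^ p = (f1 - f2) ^+ 2 * d `^ (p - 2).
    rewrite -[(_ - _) ^+ 2]real_normK ?num_real// -/d -powR_mulrn ?(ltW d0)//.
    rewrite -powRD; last by rewrite (gt_eqF d0) implybT.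
    by congr (_ `^ _); ring.
  ring.
rewrite -(mulrA (u1 * u2)) ler_pM2l//.
apply: ler_pM => //; rewrite ?powR_ge0 ?(ltW m0)//.
by apply: le_powR; rewrite ?(ltW e0)//; lra.
Qed.

End PiconeComparison.

(** * Absolutely summable families *)

(** Through [fine], [usum] reads a divergent part as 0, so its additivity and monotonicity are
    proved under this condition. *)
Definition abs_summable (R : realType) (T : choiceType) (f : T -> R) : Prop :=
  (\esum_(x in [set: T]) `|f x|%:E < +oo)%E.

Section AbsSummable.
Variables (R : realType) (T : choiceType).
Implicit Types f g h : T -> R.

Lemma abs_summable_le f g : (forall x, `|f x| <= g x) ->
  abs_summable g -> abs_summable f.
Proof.
move=> fg; apply: le_lt_trans; apply: le_esum => x _; rewrite lee_fin.
exact: le_trans (fg x) (ler_norm _).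
Qed.

Lemma abs_summableE f : (forall x, 0 <= f x) ->
  abs_summable f = (\esum_(x in [set: T]) (f x)%:E < +oo)%E.
Proof.
move=> f0; rewrite /abs_summable; congr (is_true (_ < _)%E).
by apply: eq_esum => x _; rewrite ger0_norm.
Qed.

Lemma ge0_abs_summable f : (forall x, 0 <= f x) -> abs_summable f ->
  \esum_(x in [set: T]) (f x)%:E = (fine (\esum_(x in [set: T]) (f x)%:E))%:E.
Proof.
move=> f0; rewrite abs_summableE// => fs; rewrite fineK// ge0_fin_numE//.
by apply: esum_ge0 => x _; rewrite lee_fin.
Qed.

Lemma abs_summableD f g : abs_summable f -> abs_summable g ->
  abs_summable (fun x => f x + g x).
Proof.
move=> fs gs; apply: (@abs_summable_le _ (fun x => `|f x| + `|g x|)).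
  by move=> x; exact: ler_normD.
rewrite abs_summableE; last by move=> x; rewrite addr_ge0.
under eq_esum do rewrite EFinD.
by rewrite esumD ?lte_add_pinfty// => x _; rewrite lee_fin.
Qed.

Lemma abs_summableN f : abs_summable f -> abs_summable (fun x => - f x).
Proof.
by apply: le_lt_trans; apply: le_esum => x _; rewrite normrN.
Qed.

Lemma abs_summableB f g : abs_summable f -> abs_summable g ->
  abs_summable (fun x => f x - g x).
Proof. by move=> fs gs; apply: abs_summableD => //; exact: abs_summableN. Qed.

Lemma abs_summable_norm f : abs_summable f -> abs_summable (fun x => `|f x|).
Proof. by apply: le_lt_trans; apply: le_esum => x _; rewrite normr_id. Qed.

Lemma esumZl (k : R) f : 0 <= k -> (forall x, 0 <= f x) ->
  (\esum_(x in [set: T]) (k * f x)%:E = k%:E * \esum_(x in [set: T]) (f x)%:E)%E.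
Proof.
rewrite le_eqVlt => /predU1P[<- f0|k0 f0].
  by rewrite mul0e esum1// => x _; rewrite mul0r.
rewrite /esum -ereal_sup_pZl//; congr ereal_sup; rewrite image_comp.
apply: eq_imagel => A [fA _] /=.
by rewrite ge0_mule_fsumr.
Qed.

Lemma abs_summableZ (k : R) f : abs_summable f -> abs_summable (fun x => k * f x).
Proof.
move=> fs; rewrite /abs_summable; under eq_esum do rewrite normrM.
rewrite esumZl// (ge0_abs_summable _ (abs_summable_norm fs))//.
by rewrite -EFinM ltry.
Qed.

Lemma le_esum_term f x : (forall x, 0 <= f x) ->
  ((f x)%:E <= \esum_(x in [set: T]) (f x)%:E)%E.
Proof.
move=> f0; apply: esum_ge; exists [set x]; first by split.
by rewrite fsbig_set1.
Qed.

Lemma finite_support_esum f : (forall x, 0 <= f x) -> finite_set [set x | f x != 0] ->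
  (\esum_(x in [set: T]) (f x)%:E = (\sum_(x \in [set: T]) f x)%:E)%E.
Proof.
move=> f0 fS.
have -> : \sum_(x \in [set: T]) f x = \sum_(x \in [set x | f x != 0]) f x.
  apply/esym/fsbig_widen => // x [_ /=] /negP; rewrite negbK => /eqP//.
rewrite -fsumEFin// -esum_fset//; last by move=> *; rewrite lee_fin.
rewrite [RHS]esum_mkcond; apply: eq_esum => x _.
by case: ifPn => //; rewrite notin_setE/= => /negP; rewrite negbK => /eqP->.
Qed.

Lemma finite_support_abs_summable f : finite_set [set x | f x != 0] -> abs_summable f.
Proof.
move=> fS; rewrite /abs_summable finite_support_esum ?ltry//.
by apply: sub_finite_set fS => x/=; rewrite normr_eq0.
Qed.

End AbsSummable.

(** * Unordered sums of signed families *)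

Section UnorderedSum.
Variables (R : realType) (T : countType).
Implicit Types f g h : T -> R.

Lemma abs_summable_pos_neg f : abs_summable f ->
  abs_summable f^\+ /\ abs_summable f^\-.
Proof.
move=> fs; split; apply: abs_summable_le (abs_summable_norm fs) => x; rewrite ger0_norm//.
  by rewrite ge_max ler_norm normr_ge0.
by rewrite ge_max -normrN ler_norm normr_ge0.
Qed.

(** Sum both sides of f^+ + h = f^- + g. Any splitting into summable nonnegative families thus
    computes [usum], not only the canonical one. *)
Lemma usumE f g h : (forall x, 0 <= g x) -> (forall x, 0 <= h x) ->
  abs_summable g -> abs_summable h -> (forall x, f x = g x - h x) ->
  usum f = fine (\esum_(x in [set: T]) (g x)%:E)
           - fine (\esum_(x in [set: T]) (h x)%:E).
Proof.
move=> g0 h0 gs hs fE.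
have fs : abs_summable f.
  by rewrite (_ : f = fun x => g x - h x); [exact: abs_summableB|exact/funext].
have fE' x : f x = f^\+ x - f^\- x by rewrite -[LHS](congr1 (@^~ x) (funrposBneg f)).
have [ps ns] := abs_summable_pos_neg fs.
rewrite /usum; apply/eqP; rewrite subr_eq addrAC eq_sym subr_eq; apply/eqP.
apply: EFin_inj; rewrite !EFinD -!ge0_abs_summable//.
rewrite -!esumD//; try by move=> x _; rewrite lee_fin.
apply: eq_esum => x _; rewrite -!EFinD; congr (_%:E).
by have := fE' x; rewrite fE => /eqP; rewrite subr_eq addrAC eq_sym subr_eq => /eqP.
Qed.

Lemma ge0_usumE f : (forall x, 0 <= f x) -> abs_summable f ->
  usum f = fine (\esum_(x in [set: T]) (f x)%:E).
Proof.
move=> f0 fs.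
have s0 : abs_summable (fun _ : T => 0 : R).
  by apply: abs_summable_le fs => x; rewrite normr0.
rewrite (@usumE f f (fun=> 0))// => [|x]; last by rewrite subr0.
by rewrite [X in _ - fine X]esum1// subr0.
Qed.

Lemma usum_ge0 f : (forall x, 0 <= f x) -> 0 <= usum f.
Proof.
move=> f0; rewrite /usum [X in _ - fine X]esum1 ?subr0.
  by rewrite fine_ge0// esum_ge0// => x _; rewrite lee_fin.
by move=> x _; rewrite /funrneg max_r// oppr_le0.
Qed.

Lemma usumD f g : abs_summable f -> abs_summable g ->
  usum (fun x => f x + g x) = usum f + usum g.
Proof.
move=> /abs_summable_pos_neg[fp fn] /abs_summable_pos_neg[gp gn].
rewrite (@usumE _ (fun x => f^\+ x + g^\+ x) (fun x => f^\- x + g^\- x)); first last.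
- move=> x; rewrite -{1}(funrposBneg f) -{1}(funrposBneg g) !fctE; ring.
- exact: abs_summableD.
- exact: abs_summableD.
- by move=> x; rewrite addr_ge0.
- by move=> x; rewrite addr_ge0.
have E h1 h2 : (forall x, 0 <= h1 x) -> (forall x, 0 <= h2 x) ->
   abs_summable h1 -> abs_summable h2 ->
   fine (\esum_(x in [set: T]) (h1 x + h2 x)%:E) =
   fine (\esum_(x in [set: T]) (h1 x)%:E) + fine (\esum_(x in [set: T]) (h2 x)%:E).
  move=> p1 p2 s1 s2; under eq_esum do rewrite EFinD.
  rewrite esumD; try by move=> x _; rewrite lee_fin.
  by rewrite (ge0_abs_summable p1 s1) (ge0_abs_summable p2 s2).
rewrite (E _ _ (funrpos_ge0 f) (funrpos_ge0 g) fp gp).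
by rewrite (E _ _ (funrneg_ge0 f) (funrneg_ge0 g) fn gn) opprD addrACA.
Qed.

Lemma usumN f : usum (fun x => - f x) = - usum f.
Proof.
by rewrite /usum -[fun x => - f x]/(\- f) funrposN funrnegN opprB.
Qed.

Lemma usumB f g : abs_summable f -> abs_summable g ->
  usum (fun x => f x - g x) = usum f - usum g.
Proof. by move=> fs gs; rewrite usumD ?usumN//; exact: abs_summableN. Qed.

Lemma eq_usum f g : f =1 g -> usum f = usum g.
Proof. by move=> /funext->. Qed.

Lemma usumZ (k : R) f : abs_summable f -> usum (fun x => k * f x) = k * usum f.
Proof.
wlog k0 : k / 0 <= k => [hw|].
  have [k0|/ltW k0] := leP 0 k; first exact: hw.
  move=> fs; have := hw (- k); rewrite oppr_ge0 => /(_ k0 fs).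
  move=> E; rewrite -[LHS]opprK -usumN -[RHS]opprK -mulNr -E; congr (- _).
  by apply: eq_usum => x; rewrite mulNr.
move=> /abs_summable_pos_neg[fp fn].
rewrite (@usumE _ (fun x => k * f^\+ x) (fun x => k * f^\- x)); first last.
- by move=> x; rewrite -{1}(funrposBneg f) !fctE; ring.
- exact: abs_summableZ.
- exact: abs_summableZ.
- by move=> x; rewrite mulr_ge0.
- by move=> x; rewrite mulr_ge0.
rewrite !esumZl// (ge0_abs_summable _ fp)// (ge0_abs_summable _ fn)// -!EFinM.
by rewrite -mulrBr.
Qed.

Lemma le_usum f g : abs_summable f -> abs_summable g ->
  (forall x, f x <= g x) -> usum f <= usum g.
Proof.
move=> fs gs fg; rewrite -subr_ge0 -usumB//; apply: usum_ge0 => x.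
by rewrite subr_ge0.
Qed.

Lemma le_usum_term f x : (forall x, 0 <= f x) -> abs_summable f -> f x <= usum f.
Proof.
move=> f0 fs; rewrite ge0_usumE// -lee_fin -ge0_abs_summable//.
exact: le_esum_term.
Qed.

Lemma norm_usum_le f g : abs_summable g -> (forall x, `|f x| <= g x) ->
  `|usum f| <= usum g.
Proof.
move=> gs fg; have fs := abs_summable_le fg gs.
rewrite ler_norml -usumN; apply/andP; split; apply: le_usum => //.
- exact: abs_summableN.
- by move=> x; have := fg x; rewrite ler_norml => /andP[].
- by move=> x; have := fg x; rewrite ler_norml => /andP[].
Qed.

Lemma finite_support_usum f : finite_set [set x | f x != 0] ->
  \sum_(x \in [set: T]) f x = usum f.
Proof.
move=> fS.
have fSp : finite_set [set x | f^\+ x != 0].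
  apply: sub_finite_set fS => x /=; apply: contra => /eqP fx.
  by rewrite /funrpos fx maxxx.
have fSn : finite_set [set x | f^\- x != 0].
  apply: sub_finite_set fS => x /=; apply: contra => /eqP fx.
  by rewrite /funrneg fx oppr0 maxxx.
rewrite /usum !finite_support_esum//=.
apply/eqP; rewrite eq_sym subr_eq; apply/eqP.
have E h : [set x | f x = 0] `<=` [set x | h x = 0] ->
    \sum_(x \in [set: T]) h x = \sum_(x \in [set x | f x != 0]) h x.
  move=> hf; apply/esym/fsbig_widen => // x [_ /=] /negP; rewrite negbK => /eqP.
  exact: hf.
rewrite !E//.
- rewrite -fsbig_split//; apply: eq_fsbigr => x _ /=.
  have := congr1 (@^~ x) (funrposBneg f); rewrite /= !fctE => E1.
  by apply/eqP; rewrite -subr_eq E1.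
- by move=> x /= fx; rewrite /funrneg fx oppr0 maxxx.
- by move=> x /= fx; rewrite /funrpos fx maxxx.
Qed.

End UnorderedSum.

(** * Sums over pairs of vertices *)

Section DoubleSum.
Variables (R : realType) (X : countType).
Implicit Types f : X * X -> R.

Lemma ge0_esum_pair f : (forall z, 0 <= f z) ->
  \esum_(z in [set: X * X]) (f z)%:E =
  \esum_(x in [set: X]) \esum_(y in [set: X]) (f (x, y))%:E.
Proof.
move=> f0; rewrite esum_esum; last by move=> *; rewrite lee_fin.
have -> : [set: X] `*`` (fun=> [set: X]) = [set: X * X].
  by apply/seteqP; split => // -[].
by apply: eq_esum => -[].
Qed.

Lemma ge0_usum_pair f : (forall z, 0 <= f z) -> abs_summable f ->
  [/\ forall x, abs_summable (fun y => f (x, y)),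
      abs_summable (fun x => fine (\esum_(y in [set: X]) (f (x, y))%:E)) &
      fine (\esum_(z in [set: X * X]) (f z)%:E) =
      fine (\esum_(x in [set: X])
              (fine (\esum_(y in [set: X]) (f (x, y))%:E))%:E)].
Proof.
move=> f0 fs; have fp := fs; rewrite abs_summableE// ge0_esum_pair// in fp.
have e0 x : (0 <= \esum_(y in [set: X]) (f (x, y))%:E)%E.
  by apply: esum_ge0 => y _; rewrite lee_fin.
have s1 x : abs_summable (fun y => f (x, y)).
  rewrite abs_summableE//; apply: le_lt_trans fp.
  pose F := fun x => \esum_(y in [set: X]) (f (x, y))%:E.
  apply: esum_ge; exists [set x]; first by split.
  by rewrite fsbig_set1.
have E : \esum_(x in [set: X]) \esum_(y in [set: X]) (f (x, y))%:E =
  \esum_(x in [set: X]) (fine (\esum_(y in [set: X]) (f (x, y))%:E))%:E.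
  by apply: eq_esum => x _; rewrite [LHS]ge0_abs_summable.
split => //; last by rewrite ge0_esum_pair// E.
by rewrite abs_summableE -?E// => x; rewrite fine_ge0.
Qed.

(** Tonelli for each of the two parts. The row sums of the parts are in general not the parts of the
    row sums, but [usumE] accepts them. *)
Lemma usum_pair f : abs_summable f ->
  usum f = usum (fun x => usum (fun y => f (x, y))).
Proof.
move=> /abs_summable_pos_neg[/ge0_usum_pair[]// p1 p2 p3 /ge0_usum_pair[]// n1 n2 n3].
rewrite [LHS]/usum p3 n3; apply/esym/usumE => //.
- by move=> x; rewrite fine_ge0// esum_ge0// => y _; rewrite lee_fin.
- by move=> x; rewrite fine_ge0// esum_ge0// => y _; rewrite lee_fin.
Qed.

Lemma abs_summable_swap f : abs_summable f -> abs_summable (fun z => f (z.2, z.1)).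
Proof.
apply: le_lt_trans.
rewrite [leRHS](@reindex_esum _ _ _ [set: X * X] _ (fun z => (z.2, z.1)))//.
by split => // [[a b] [c d] _ _ /= [-> ->]|[a b] _]//; exists (b, a).
Qed.

Lemma usum_swap f : usum (fun z => f (z.2, z.1)) = usum f.
Proof.
rewrite /usum; congr (fine _ - fine _); apply/esym.
- rewrite [LHS](@reindex_esum _ _ _ [set: X * X] _ (fun z => (z.2, z.1)))//.
  by split => // [[a b] [c d] _ _ /= [-> ->]|[a b] _]//; exists (b, a).
- rewrite [LHS](@reindex_esum _ _ _ [set: X * X] _ (fun z => (z.2, z.1)))//.
  by split => // [[a b] [c d] _ _ /= [-> ->]|[a b] _]//; exists (b, a).
Qed.

Lemma finite_support_abs_summable_pair (phi : X -> R) (k : X -> X -> R) :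
  finite_set [set x | phi x != 0] -> (forall x, abs_summable (k x)) ->
  abs_summable (fun z : X * X => phi z.1 * k z.1 z.2).
Proof.
move=> phiS ks; rewrite /abs_summable ge0_esum_pair//=.
have -> : \esum_(x in [set: X]) \esum_(y in [set: X]) (`|phi x * k x y|)%:E =
  \esum_(x in [set: X]) (`|phi x| * fine (\esum_(y in [set: X]) (`|k x y|)%:E))%:E.
  apply: eq_esum => x _; under eq_esum do rewrite normrM.
  by rewrite esumZl// (ge0_abs_summable _ (abs_summable_norm (ks x))).
have e0 x : 0 <= fine (\esum_(y in [set: X]) (`|k x y|)%:E).
  by rewrite fine_ge0// esum_ge0.
rewrite finite_support_esum ?ltry//; first by move=> x; rewrite mulr_ge0.
by apply: sub_finite_set phiS => x /=; rewrite mulf_eq0 normr_eq0 negb_or => /andP[].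
Qed.

End DoubleSum.

(** * Supersolutions and Green functions *)

Section SignedPowerContinuity.
Variable R : realType.
Implicit Types a c d q : R.

Lemma signed_powMM q a c : signed_pow (a * c) q = signed_pow a q * signed_pow c q.
Proof. by rewrite /signed_pow normrM powRM//; ring. Qed.

(* Uniformity in a, up to the weight 1 + |a|^q, is what lets this pass through
   an infinite sum over the neighbours of a vertex. *)
Lemma signed_pow_modulus q (e : R) : 0 < q -> 0 < e ->
  exists2 d : R, 0 < d & forall a c, `|c - a| <= d ->
    `|signed_pow c q - signed_pow a q| <= e * (1 + `|a| `^ q).
Proof.
move=> q0 e0.
have iq0 : 0 < q^-1 by rewrite invr_gt0.
have rt (x : R) : 0 <= x -> (x `^ q^-1) `^ q = x.
  by move=> x0; rewrite -powRrM mulVf ?gt_eqF// powRr1.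
(* For large |a|, dividing by [a] reduces the claim to continuity at 1. *)
have [n1 n10 hn1] : exists2 n : R, 0 < n & forall x : R, `|x - 1| <= n -> `|signed_pow x q - 1| <= e.
  pose x1 := (1 + e) `^ q^-1; pose x0 := (Num.max 0 (1 - e)) `^ q^-1.
  have m0 : 0 <= Num.max 0 (1 - e) by rewrite le_max lexx.
  have sx1 : signed_pow x1 q = 1 + e.
    by rewrite ge0_signed_powE ?powR_ge0// rt//; lra.
  have sx0 : signed_pow x0 q = Num.max 0 (1 - e).
    by rewrite ge0_signed_powE ?powR_ge0// rt.
  have s1 : signed_pow 1 q = 1 :> R by rewrite ge0_signed_powE// powR1.
  clearbody x1 x0.
  exists (Num.min (x1 - 1) (1 - x0)).
    rewrite lt_min !subr_gt0; apply/andP; split; rewrite ltNge; apply/negP => /(le_signed_pow q0).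
      by rewrite sx1 s1; lra.
    by rewrite sx0 s1 le_max; lra.
  move=> x; rewrite le_min => /andP[h1 h2].
  have /(le_signed_pow q0) : x <= x1 by have := le_trans (ler_norm _) h1; lra.
  have /(le_signed_pow q0) : x0 <= x.
    by move: h2; rewrite distrC => /(le_trans (ler_norm _)); lra.
  by rewrite sx0 sx1 ge_max ler_norml => /andP[_ h3] h4; lra.
(* For |a| <= n both |a| and |c| are at most 2 n, and (2 n)^q = e/2. *)
pose n := (e / 2) `^ q^-1 / 2.
have n0 : 0 < n by rewrite divr_gt0// powR_gt0// divr_gt0.
have hn : (2 * n) `^ q = e / 2.
  have -> : 2 * n = (e / 2) `^ q^-1 by rewrite /n; field.
  by rewrite rt// divr_ge0// ltW.
exists (Num.min n (n * n1)).
  by rewrite lt_min n0 mulr_gt0.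
move=> a c; rewrite le_min => /andP[h1 h2].
have [an|an] := leP `|a| n.
  have h3 : `|signed_pow c q| <= e / 2.
    rewrite norm_signed_pow// -hn; apply: le_powR => //; first exact: ltW.
    have -> : c = (c - a) + a by ring.
    by apply: le_trans (ler_normD _ _) _; lra.
  have h4 : `|signed_pow a q| <= e / 2.
    rewrite norm_signed_pow// -hn; apply: le_powR => //; first exact: ltW.
    lra.
  apply: le_trans (ler_normB _ _) _.
  have : 0 <= e * `|a| `^ q by rewrite mulr_ge0 ?powR_ge0// ltW.
  lra.
have na : 0 < `|a| by exact: lt_trans an.
have a0 : a != 0 by rewrite -normr_gt0.
have ec : c = a * (c / a) by rewrite mulrC divfK.
rewrite {1}ec signed_powMM -{2}(mulr1 (signed_pow a q)) -mulrBr normrM norm_signed_pow//.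
have h : `|signed_pow (c / a) q - 1| <= e.
  apply: hn1; have -> : c / a - 1 = (c - a) / a by field.
  rewrite normrM normfV ler_pdivrMr//; apply: (le_trans h2).
  by rewrite mulrC ler_pM2l// ltW.
apply: (@le_trans _ _ (`|a| `^ q * e)); first by rewrite ler_wpM2l// powR_ge0.
lra.
Qed.

Lemma powR_add_le q a c : 0 <= q -> 0 <= a -> 0 <= c ->
  (a + c) `^ q <= 2 `^ q * (a `^ q + c `^ q).
Proof.
move=> q0 a0 c0.
have main (x y : R) : 0 <= x -> 0 <= y -> x <= y -> (x + y) `^ q <= 2 `^ q * (x `^ q + y `^ q).
  move=> x0 y0 xy; apply: (@le_trans _ _ ((2 * y) `^ q)).
    by apply: le_powR; rewrite ?addr_ge0//; lra.
  by rewrite powRM// ler_wpM2l ?powR_ge0// lerDr powR_ge0.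
have [ac|ca] := leP a c; first exact: main.
by rewrite addrC (addrC (a `^ q)); apply: main => //; exact: ltW.
Qed.

End SignedPowerContinuity.

(** * The p-Laplacian and its Green functions *)

Section PLaplacian.
Variables (R : realType) (X : countType) (p : R) (b : X -> X -> R) (m : X -> R).
Hypotheses (p_gt1 : 1 < p) (b_graph : is_graph b) (m_gt0 : strictly_positive_fun m).
Implicit Types f g h w : X -> R.

Let q_gt0 : 0 < p - 1. Proof. by rewrite subr_gt0. Qed.

Lemma graph_abs_summable x : abs_summable (b x).
Proof.
by rewrite abs_summableE; [exact: graph_summable|exact: graph_ge0].
Qed.

Lemma formal_domainE f :
  formal_domain p b f <->
  forall x, abs_summable (fun y => b x y * `|f x - f y| `^ (p - 1)).
Proof.
by split => fd x; have := fd x; rewrite abs_summableE// => y;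
  rewrite mulr_ge0 ?powR_ge0 ?graph_ge0.
Qed.

Lemma formal_domain_le f g : (forall x y, `|f x - f y| <= `|g x - g y|) ->
  formal_domain p b g -> formal_domain p b f.
Proof.
move=> fg /formal_domainE gd; apply/formal_domainE => x.
apply: abs_summable_le (gd x) => y.
rewrite ger0_norm ?mulr_ge0 ?powR_ge0 ?graph_ge0//.
rewrite ler_wpM2l ?(graph_ge0 b_graph)//; apply: le_powR => //; exact: ltW.
Qed.

Lemma abs_summable_signed_pow x (f : X -> R) t :
  abs_summable (fun y => b x y * `|t - f y| `^ (p - 1)) ->
  abs_summable (fun y => b x y * signed_pow (t - f y) (p - 1)).
Proof.
apply: abs_summable_le => y.
by rewrite normrM (ger0_norm (graph_ge0 b_graph _ _)) norm_signed_pow.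
Qed.

Lemma formal_domain_abs_summable f x : formal_domain p b f ->
  abs_summable (fun y => b x y * signed_pow (f x - f y) (p - 1)).
Proof. by move=> /formal_domainE fd; exact: abs_summable_signed_pow. Qed.

(** The increment is at most |t| + |w x| + |w x - w y|, and [b x] is summable. With [t] free, the
    operator stays meaningful when the value at [x] alone is changed. *)
Lemma dominated_abs_summable h w x t : formal_domain p b w ->
  (forall y, 0 <= h y <= w y) ->
  abs_summable (fun y => b x y * `|t - h y| `^ (p - 1)).
Proof.
move=> /formal_domainE wd hw.
pose k := 2 `^ (p - 1) : R.
have k0 : 0 <= k by exact: powR_ge0.
apply: (@abs_summable_le _ _ _ (fun y => k * ((`|t| + `|w x|) `^ (p - 1) * b x y +
    b x y * `|w x - w y| `^ (p - 1)))); last first.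
  apply: abs_summableZ; apply: abs_summableD => //; apply: abs_summableZ.
  exact: graph_abs_summable.
move=> y; rewrite ger0_norm ?mulr_ge0 ?powR_ge0 ?graph_ge0//.
apply: (@le_trans _ _ (b x y * (k * ((`|t| + `|w x|) `^ (p - 1) + `|w x - w y| `^ (p - 1))))).
  rewrite ler_wpM2l ?(graph_ge0 b_graph)//.
  have := powR_add_le (ltW q_gt0) (addr_ge0 (normr_ge0 t) (normr_ge0 (w x)))
    (normr_ge0 (w x - w y)).
  apply: le_trans.
  apply: le_powR => //; first exact: ltW.
  have /andP[h0 hle] := hw y.
  apply: le_trans (ler_normB _ _) _; rewrite (ger0_norm h0) -addrA lerD2l.
  apply: (le_trans hle); apply: le_trans (ler_norm _) _.
  by rewrite -lerBlDl; apply: le_trans (lerB_dist _ _) _; rewrite distrC.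
by rewrite le_eqVlt; apply/orP; left; apply/eqP; ring.
Qed.

Lemma dominated_formal_domain h w : formal_domain p b w ->
  (forall y, 0 <= h y <= w y) -> formal_domain p b h.
Proof. by move=> wd hw; apply/formal_domainE => x; exact: dominated_abs_summable wd hw. Qed.

Definition vertex_operator (alpha : R) (h : X -> R) (x : X) (t : R) : R :=
  (m x)^-1 * usum (fun y => b x y * signed_pow (t - h y) (p - 1))
  + alpha * signed_pow t (p - 1).

Lemma vertex_operator_continuous alpha h x t (e : R) :
  (forall s, abs_summable (fun y => b x y * `|s - h y| `^ (p - 1))) ->
  0 < e -> exists2 d : R, 0 < d & forall s, `|s - t| <= d ->
    `|vertex_operator alpha h x s - vertex_operator alpha h x t| <= e.
Proof.
move=> hs e0.
pose F s y := b x y * signed_pow (s - h y) (p - 1).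
have Fs s : abs_summable (F s) by exact: abs_summable_signed_pow.
pose B y := b x y + b x y * `|t - h y| `^ (p - 1).
have Bs : abs_summable B by apply: abs_summableD => //; exact: graph_abs_summable.
have B0 y : 0 <= B y.
  by rewrite addr_ge0 ?mulr_ge0 ?powR_ge0 ?(graph_ge0 b_graph).
pose K := (m x)^-1 * usum B + `|alpha| * (1 + `|t| `^ (p - 1)).
have mi : 0 < (m x)^-1 by rewrite invr_gt0.
have K0 : 0 <= K.
  by rewrite addr_ge0// mulr_ge0 ?usum_ge0 ?(ltW mi)// addr_ge0 ?powR_ge0.
have K1 : 0 < K + 1 by lra.
have [d d0 hd] := @signed_pow_modulus R (p - 1) (e / (K + 1)) q_gt0 (divr_gt0 e0 K1).
exists d => // s st.
have -> : vertex_operator alpha h x s - vertex_operator alpha h x t =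
    (m x)^-1 * usum (fun y => F s y - F t y) +
    alpha * (signed_pow s (p - 1) - signed_pow t (p - 1)).
  rewrite usumB//; set As := usum (F s); set At := usum (F t).
  have -> : vertex_operator alpha h x s = (m x)^-1 * As + alpha * signed_pow s (p - 1) by [].
  have -> : vertex_operator alpha h x t = (m x)^-1 * At + alpha * signed_pow t (p - 1) by [].
  clearbody As At; ring.
apply: (@le_trans _ _ (e / (K + 1) * K)); last first.
  by rewrite mulrAC ler_pdivrMr// ler_pM2l//; lra.
apply: le_trans (ler_normD _ _) _; rewrite !normrM (gtr0_norm mi).
have h1 : `|usum (fun y => F s y - F t y)| <= e / (K + 1) * usum B.
  rewrite -usumZ//; apply: norm_usum_le; first exact: abs_summableZ.
  move=> y; rewrite /F -mulrBr normrM (ger0_norm (graph_ge0 b_graph _ _)).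
  have -> : e / (K + 1) * B y = b x y * (e / (K + 1) * (1 + `|t - h y| `^ (p - 1))).
    by rewrite /B; ring.
  rewrite ler_wpM2l ?(graph_ge0 b_graph)//; apply: hd.
  by have -> : s - h y - (t - h y) = s - t by ring.
have h2 := hd _ _ st.
have := ler_wpM2l (ltW mi) h1; have := ler_wpM2l (normr_ge0 alpha) h2.
rewrite /K; lra.
Qed.

Lemma vertex_operatorE alpha f x :
  schrodinger p b m (cst alpha) f x = vertex_operator alpha f x (f x).
Proof. by []. Qed.

(** Larger neighbours lower the operator; this is what makes minima and infima of supersolutions
    supersolutions again. *)
Lemma le_vertex_operator alpha g h x t :
  abs_summable (fun y => b x y * `|t - g y| `^ (p - 1)) ->
  abs_summable (fun y => b x y * `|t - h y| `^ (p - 1)) ->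
  (forall y, g y <= h y) ->
  vertex_operator alpha h x t <= vertex_operator alpha g x t.
Proof.
move=> gs hs gh; apply: lerD => //; apply: ler_wpM2l; first by rewrite invr_ge0 ltW.
apply: le_usum; try exact: abs_summable_signed_pow.
move=> y; rewrite ler_wpM2l ?(graph_ge0 b_graph)//; apply: le_signed_pow => //.
by rewrite lerD2l lerN2.
Qed.

Lemma vertex_operator0_le alpha h x : (forall y, 0 <= h y) ->
  vertex_operator alpha h x 0 <= 0.
Proof.
move=> h0; rewrite /vertex_operator signed_pow0 mulr0 addr0.
rewrite pmulr_rle0 ?invr_gt0// -oppr_ge0 -usumN; apply: usum_ge0 => y.
by rewrite -mulrN mulr_ge0 ?(graph_ge0 b_graph)// oppr_ge0 signed_pow_le0// sub0r oppr_le0.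
Qed.

(* The pointwise infimum of all supersolutions below w is a supersolution;
   where it were strict, lowering its value at that vertex would produce a
   smaller one. *)
Lemma green_below_supersolution alpha o w :
  formal_domain p b w -> (forall x, 0 <= w x) ->
  (forall x, \1_[set o] x <= schrodinger p b m (cst alpha) w x) ->
  exists2 h, is_green p b m alpha o h & forall x, h x <= w x.
Proof.
move=> wd w0 wsup.
pose S := [set g : X -> R | (forall x, 0 <= g x <= w x) /\
  forall x, \1_[set o] x <= vertex_operator alpha g x (g x)].
pose V x := [set g x | g in S].
have Sw : S w by split => // x; rewrite w0/=.
have V0 x : V x !=set0 by exists (w x), w.
have Vlb x : has_lbound (V x) by exists 0 => _ [g [g0 _] <-]; case/andP: (g0 x).
pose h x := inf (V x).
have hle g x : S g -> h x <= g x.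
  by move=> Sg; apply: ge_inf => //; exists g.
have h0 x : 0 <= h x.
  by apply: lb_le_inf => // _ [g [g0 _] <-]; case/andP: (g0 x).
have hw x : 0 <= h x <= w x by rewrite h0 hle.
have gs g : (forall x, 0 <= g x <= w x) ->
    forall x t, abs_summable (fun y => b x y * `|t - g y| `^ (p - 1)).
  by move=> gw x t; exact: dominated_abs_summable wd gw.
have hsup x : \1_[set o] x <= vertex_operator alpha h x (h x).
  rewrite leNgt; apply/negP => lt1.
  set e := (\1_[set o] x - vertex_operator alpha h x (h x)) / 2.
  have e0 : 0 < e by rewrite divr_gt0// subr_gt0.
  have [d d0 hd] := vertex_operator_continuous alpha (h x) (gs _ hw x) e0.
  have [|_ [g Sg <-] glt] := @inf_adherent _ (V x) _ d0; first by split.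
  have := Sg.2 x; apply/negP; rewrite -ltNge.
  (* The near-minimiser [g] satisfies the inequality with neighbours above [h]; lowering them to [h]
     keeps it, and continuity replaces [g x] by [h x]. *)
  apply: (@le_lt_trans _ _ (vertex_operator alpha h x (g x))).
    apply: le_vertex_operator; [exact: gs|apply: gs; exact: Sg.1|].
    by move=> y; exact: hle.
  have := hd (g x); rewrite ger0_norm ?subr_ge0 ?hle// lerBlDl (ltW glt) => /(_ isT).
  by rewrite ler_norml /e => /andP[_]; lra.
have hsub x : vertex_operator alpha h x (h x) <= \1_[set o] x.
  rewrite leNgt; apply/negP => lt1.
  (* At value 0 the operator is nonpositive, so an excess over the indicator leaves room to lower
     [h x]. *)
  have hx0 : 0 < h x.
    rewrite lt_neqAle h0 andbT eq_sym; apply/eqP => hx.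
    have : 0 <= \1_[set o] x :> R by rewrite indicE.
    by have := vertex_operator0_le alpha x h0; rewrite hx in lt1; lra.
  set e := (vertex_operator alpha h x (h x) - \1_[set o] x) / 2.
  have e0 : 0 < e by rewrite divr_gt0// subr_gt0.
  have [d d0 hd] := vertex_operator_continuous alpha (h x) (gs _ hw x) e0.
  pose t := h x - Num.min d (h x).
  have md : 0 < Num.min d (h x) by rewrite lt_min d0.
  have mle : Num.min d (h x) <= h x by rewrite ge_min lexx orbT.
  have mld : Num.min d (h x) <= d by rewrite ge_min lexx.
  have tlt : t < h x by rewrite /t; lra.
  pose g y := if y == x then t else h y.
  have gh y : g y <= h y.
    by rewrite /g; case: eqVneq => [->|//]; exact: ltW.
  have gw y : 0 <= g y <= w y.
    rewrite (le_trans (gh y)) ?andbT; last by case/andP: (hw y).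
    by rewrite /g; case: eqVneq => // _; rewrite subr_ge0.
  suff Sg : S g by have := hle g x Sg; rewrite /g eqxx leNgt tlt.
  (* Away from [x], lowering one neighbour raises the operator; at [x], continuity uses up only half
     of the excess. *)
  split => // y; have [->|yx] := eqVneq y x; last first.
    have -> : g y = h y by rewrite /g (negPf yx).
    by apply: le_trans (hsup y) _; apply: le_vertex_operator => //; exact: gs.
  have -> : vertex_operator alpha g x (g x) = vertex_operator alpha h x t.
    have -> : g x = t by rewrite /g eqxx.
    rewrite /vertex_operator (@eq_usum _ _ _ (fun z => b x z * signed_pow (t - h z) (p - 1)))//.
    move=> z; rewrite /g; case: eqVneq => [->|//].
    by rewrite (graph_diag b_graph) !mul0r.
  have : `|t - h x| <= d by rewrite ler_norml /t; lra.
  by move=> /hd; rewrite ler_norml /e => /andP[+ _]; lra.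
have heq x : schrodinger p b m (cst alpha) h x = \1_[set o] x.
  by apply/eqP; rewrite eq_le vertex_operatorE hsup hsub.
exists h; last by move=> x; exact: hle.
split => //; last exact: dominated_formal_domain wd hw.
split => // hE; have := heq o; rewrite vertex_operatorE indicE mem_set// hE.
have := @vertex_operator0_le alpha (cst 0) o (fun=> lexx 0).
move=> + E; have {}E : vertex_operator alpha (cst 0) o 0 = 1 := E.
by rewrite E ler10.
Qed.

(** At a zero the potential term vanishes and all increments are nonpositive, so superharmonicity
    makes every neighbour a zero; connectedness spreads this. *)
Lemma superharmonic_gt0 V f : connected_graph b -> positive_fun f ->
  schrodinger_superharmonic p b m V f -> strictly_positive_fun f.
Proof.
move=> bconn [f0 fn0] [fd fsup].
have zero_step x y : f x = 0 -> 0 < b x y -> f y = 0.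
  move=> fx bxy; have := fsup x.
  rewrite /schrodinger /p_laplacian fx signed_pow0 mulr0 addr0 pmulr_rge0 ?invr_gt0//.
  rewrite -oppr_le0 -usumN => le0.
  apply/eqP; rewrite eq_le f0 andbT leNgt; apply/negP => fy.
  move: le0; apply/negP; rewrite -ltNge.
  pose k z := - (b x z * signed_pow (0 - f z) (p - 1)).
  have kE z : k z = b x z * f z `^ (p - 1).
    by rewrite /k sub0r signed_powN mulrN opprK ge0_signed_powE.
  apply: lt_le_trans (_ : k y <= _).
    by rewrite kE mulr_gt0// powR_gt0.
  apply: le_usum_term.
    by move=> z; rewrite kE mulr_ge0 ?powR_ge0 ?(graph_ge0 b_graph).
  by apply: abs_summableN; have := formal_domain_abs_summable x fd; rewrite fx.
move=> x; rewrite lt_neqAle f0 andbT eq_sym; apply/eqP => fx.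
apply: fn0; apply/funext => y; have [s sp <-] := bconn x y.
elim: s x fx sp => //= z s ih x fx /andP[bxz sp].
exact: ih (zero_step _ _ fx bxz) sp.
Qed.

Lemma minimal_green_le alpha o G f : minimal_green p b m alpha o G ->
  formal_domain p b f -> strictly_positive_fun f ->
  (forall x, 0 <= schrodinger p b m (cst alpha) f x) ->
  exists2 s : R, 0 <= s & forall x, G x <= s * f x.
Proof.
move=> [[[G0 _] Gd GE] Gmin] fd f0 fsup.
pose s := G o / f o.
have s0 : 0 <= s by rewrite divr_ge0// ltW.
pose w x := Num.min (G x) (s * f x).
have w0 x : 0 <= w x by rewrite le_min G0 mulr_ge0// ltW.
have wG x : w x <= G x by rewrite ge_min lexx.
have ws x : w x <= s * f x by rewrite ge_min lexx orbT.
have wd : formal_domain p b w.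
  by apply: dominated_formal_domain Gd _ => x; rewrite w0 wG.
have sfd x : abs_summable (fun y => b x y * `|s * f x - s * f y| `^ (p - 1)).
  have /formal_domainE/(_ x)/(abs_summableZ (s `^ (p - 1))) := fd.
  apply: abs_summable_le => y.
  have -> : `|s * f x - s * f y| = s * `|f x - f y|.
    by rewrite -mulrBr normrM (ger0_norm s0).
  rewrite powRM// ger0_norm; first by rewrite le_eqVlt; apply/orP; left; apply/eqP; ring.
  by rewrite !mulr_ge0 ?powR_ge0 ?(graph_ge0 b_graph).
have sE x : vertex_operator alpha (fun y => s * f y) x (s * f x) =
    s `^ (p - 1) * schrodinger p b m (cst alpha) f x.
  rewrite vertex_operatorE /vertex_operator signed_powM//.
  rewrite (_ : usum (fun y => b x y * signed_pow (s * f x - s * f y) (p - 1)) =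
    s `^ (p - 1) * usum (fun y => b x y * signed_pow (f x - f y) (p - 1))).
    by move: (usum _) => Z; ring.
  rewrite -usumZ; last exact: formal_domain_abs_summable.
  by apply: eq_usum => y; rewrite -mulrBr signed_powM//; ring.
have wds := (formal_domainE w).1 wd.
have [|h /Gmin hG hw] := @green_below_supersolution alpha o w wd w0; last first.
  by exists s => // x; apply: le_trans (hG x) (le_trans (hw x) (ws x)).
move=> x; rewrite vertex_operatorE.
(* The choice of [s] makes both functions agree at [o]; where [s f] is strictly smaller the source
   is 0 and bare superharmonicity is enough. *)
have [wx|wx] : w x = G x \/ (w x = s * f x /\ x <> o).
  rewrite /w; case: leP => h; [left|right] => //; split => // xo; move: h.
  by rewrite xo /s divfK ?ltxx// gt_eqF.
  rewrite -GE vertex_operatorE wx; apply: le_vertex_operator => //.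
    by have := wds x; rewrite wx.
  exact: (formal_domainE G).1.
case: wx => wx xo; rewrite indicE memNset//= wx.
apply: (@le_trans _ _ (vertex_operator alpha (fun y => s * f y) x (s * f x))).
  by rewrite sE mulr_ge0 ?powR_ge0.
apply: le_vertex_operator => //; by have := wds x; rewrite wx.
Qed.

End PLaplacian.

(** * Energy and null families *)

Section Energy.
Variables (R : realType) (X : countType) (p : R) (b : X -> X -> R) (m : X -> R).
Hypotheses (p_gt1 : 1 < p) (b_graph : is_graph b) (m_gt0 : strictly_positive_fun m).
Implicit Types f g psi : X -> R.

Let p_gt0 : 0 < p. Proof. exact: lt_trans p_gt1. Qed.
Let p_neq0 : p != 0. Proof. by rewrite gt_eqF. Qed.

Definition picone_edge g psi (z : X * X) : R :=
  b z.1 z.2 * picone p (g z.1) (g z.2) (psi z.1) (psi z.2).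

(** Ground state representation: the operator of [g] is tested against g psi^p. The subtracted part
    of the remainder is [K] plus its transpose, whose two equal sums cancel the factor 1/2. *)
Lemma energy_picone V g psi : formal_domain p b g -> (forall x, 0 <= g x) ->
  c_c psi -> (forall x, 0 <= psi x) ->
  abs_summable (picone_edge g psi) /\
  energy p b m V (fun x => g x * psi x) =
  (2^-1 * usum (picone_edge g psi) +
   usum (fun x => m x * schrodinger p b m V g x * (g x * psi x `^ p)))%:E.
Proof.
move=> gd g0 psic psi0.
have supp (h : X -> R) : (forall x, psi x = 0 -> h x = 0) -> finite_set [set x | h x != 0].
  move=> hpsi; apply: sub_finite_set psic => x /=; apply: contra => /eqP psix.
  by apply/eqP/hpsi.
pose phi x := g x * psi x `^ p.
pose k x y := b x y * signed_pow (g x - g y) (p - 1).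
have ks x : abs_summable (k x) by exact: formal_domain_abs_summable.
have phiS : finite_set [set x | phi x != 0].
  by apply: supp => x psix; rewrite /phi psix powR0// mulr0.
pose K (z : X * X) := phi z.1 * k z.1 z.2.
have Ks : abs_summable K by exact: finite_support_abs_summable_pair.
pose A (z : X * X) := b z.1 z.2 * `|g z.1 * psi z.1 - g z.2 * psi z.2| `^ p.
have A0 z : 0 <= A z by rewrite mulr_ge0 ?powR_ge0 ?(graph_ge0 b_graph).
pose eta x := `|g x * psi x| `^ p.
have etaS : finite_set [set x | eta x != 0].
  by apply: supp => x psix; rewrite /eta psix mulr0 normr0 powR0.
have As : abs_summable A.
  pose P (z : X * X) := eta z.1 * b z.1 z.2.
  have Ps : abs_summable P.
    apply: finite_support_abs_summable_pair => //; exact: graph_abs_summable.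
  apply: abs_summable_le (abs_summableZ (2 `^ p) (abs_summableD Ps (abs_summable_swap Ps))).
  move=> z; rewrite ger0_norm// /A /P /= (graph_sym b_graph z.2).
  have -> : 2 `^ p * (eta z.1 * b z.1 z.2 + eta z.2 * b z.1 z.2) =
    b z.1 z.2 * (2 `^ p * (eta z.1 + eta z.2)) by ring.
  rewrite ler_wpM2l ?(graph_ge0 b_graph)//.
  have p0 := ltW p_gt0.
  apply: le_trans (powR_add_le p0 (normr_ge0 _) (normr_ge0 _)).
  by apply: le_powR => //; exact: ler_normB.
have KK := abs_summableD Ks (abs_summable_swap Ks).
have picE z : picone_edge g psi z = A z - (K z + K (z.2, z.1)).
  rewrite /picone_edge /picone /A /K /k /phi/= (graph_sym b_graph z.2).
  by rewrite -(opprB (g z.1) (g z.2)) signed_powN; ring.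
have pics : abs_summable (picone_edge g psi).
  by rewrite (_ : picone_edge g psi = fun z => A z - (K z + K (z.2, z.1)));
    [exact: abs_summableB|exact/funext].
split => //.
have uK : usum K = usum (fun x => m x * p_laplacian p b m g x * phi x).
  rewrite usum_pair//; apply: eq_usum => x; rewrite /K /= usumZ//.
  by rewrite /p_laplacian (mulrA (m x)) divff ?gt_eqF// mul1r mulrC.
rewrite (eq_usum picE) usumB// usumD//; last exact: abs_summable_swap.
rewrite usum_swap uK.
rewrite /energy (ge0_abs_summable A0 As) -(ge0_usumE A0 As).
rewrite finite_support_usum; last first.
  by apply: supp => x psix; rewrite psix mulr0 normr0 powR0// mulr0.
rewrite -EFinM -EFinD; congr (_%:E).
rewrite [in RHS](_ : usum (fun x => m x * schrodinger p b m V g x * (g x * psi x `^ p)) =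
  usum (fun x => m x * p_laplacian p b m g x * phi x) +
  usum (fun x => m x * V x * `|g x * psi x| `^ p)); first by field.
rewrite -usumD.
- apply: eq_usum => x; rewrite /schrodinger /phi normrM powRM// (ger0_norm (psi0 x)).
  by rewrite -mulr_signed_pow//; ring.
- apply: finite_support_abs_summable; apply: supp => x psix.
  by rewrite /phi psix powR0// !mulr0.
- apply: finite_support_abs_summable; apply: supp => x psix.
  by rewrite psix mulr0 normr0 powR0// !mulr0.
Qed.

(** The two products are one function with one energy: represented through [f] its vertex term is
    nonnegative, through [g] nonpositive. *)
Lemma usum_picone_edge_le V f g eta psi :
  schrodinger_superharmonic p b m V f -> (forall x, 0 <= f x) ->
  formal_domain p b g -> (forall x, schrodinger p b m V g x <= 0) ->
  (forall x, 0 <= g x) -> c_c eta -> (forall x, 0 <= eta x) ->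
  c_c psi -> (forall x, 0 <= psi x) ->
  (forall x, f x * eta x = g x * psi x) ->
  usum (picone_edge f eta) <= usum (picone_edge g psi).
Proof.
move=> [fd fsup] f0 gd gsub g0 etac eta0 psic psi0 /funext fg.
have [_] := energy_picone V fd f0 etac eta0; rewrite fg.
have [_ ->] := energy_picone V gd g0 psic psi0.
set F := usum (fun x => m x * _ * (f x * _)); set G := usum (fun x => m x * _ * (g x * _)).
have F0 : 0 <= F.
  apply: usum_ge0 => x; apply: mulr_ge0; last exact: mulr_ge0 (f0 x) (powR_ge0 _ _).
  exact: mulr_ge0 (ltW (m_gt0 x)) (fsup x).
have G0 : 0 <= - G.
  rewrite -usumN; apply: usum_ge0 => x; rewrite -mulNr -mulrN.
  apply: mulr_ge0; last exact: mulr_ge0 (g0 x) (powR_ge0 _ _).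
  by apply: mulr_ge0; [exact: ltW (m_gt0 x)|rewrite oppr_ge0; exact: gsub].
clearbody F G; move: (usum _) (usum _) => A B [AB]; lra.
Qed.

Lemma picone_edge_ge0 g psi z : strictly_positive_fun g -> (forall x, 0 <= psi x) ->
  0 <= picone_edge g psi z.
Proof.
by move=> g0 psi0; rewrite mulr_ge0 ?(graph_ge0 b_graph)// picone_ge0.
Qed.

Lemma picone_edgeM g psi (k : R) z : 0 <= k -> (forall x, 0 <= psi x) ->
  picone_edge g (fun x => k * psi x) z = k `^ p * picone_edge g psi z.
Proof.
move=> k0 psi0; rewrite /picone_edge /picone !powRM//.
have -> : g z.1 * (k * psi z.1) - g z.2 * (k * psi z.2) =
  k * (g z.1 * psi z.1 - g z.2 * psi z.2) by ring.
by rewrite normrM powRM// (ger0_norm k0); ring.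
Qed.

Lemma critical_null_family V v o (e : R) : critical p b m V ->
  schrodinger_superharmonic p b m V v -> strictly_positive_fun v -> 0 < e ->
  exists psi, [/\ c_c psi, forall x, 0 <= psi x, psi o = 1,
    abs_summable (picone_edge v psi) & usum (picone_edge v psi) <= e].
Proof.
move=> [Hpos nsub] [vd vsup] v0 e0.
have v0' x : 0 <= v x by exact: ltW.
have mvo : 0 < m o * v o `^ p by rewrite mulr_gt0// powR_gt0.
(* Criticality is tested with a weight at the single vertex [o]; its size makes the weighted term of
   v psi equal to e/2 psi(o)^p. *)
pose W x : R := if x == o then e / 2 / (m o * v o `^ p) else 0.
have W0 : positive_fun W.
  split => [x|].
    by rewrite /W; case: ifP => // _; rewrite !divr_ge0// ltW.
  move=> /(congr1 (@^~ o)); rewrite /W eqxx/=; apply/eqP.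
  by rewrite gt_eqF// !divr_gt0.
have [phi [phic phiE]] : exists phi : X -> R, c_c phi /\
    (energy p b m (fun x => V x - W x)%R phi < 0)%E.
  apply: contrapT => hn; apply: nsub; split => //; exists W => // phi phic.
  by rewrite leNgt; apply/negP => h; apply: hn; exists phi.
pose psi x := `|phi x| / v x.
have psi0 x : 0 <= psi x by rewrite divr_ge0.
have psic : c_c psi.
  apply: sub_finite_set phic => x /=; apply: contra => /eqP phix.
  by rewrite /psi phix normr0 mul0r.
have [pics] := energy_picone (fun x => V x - W x) vd v0' psic psi0.
set S := usum (fun x => m x * _ * _) => Een.
(* Passing to |phi| does not raise the energy and makes the quotient by [v] nonnegative. *)
have Ele : (energy p b m (fun x => V x - W x)%R (fun x => v x * psi x)%R <=
            energy p b m (fun x => V x - W x)%R phi)%E.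
  have -> : (fun x => v x * psi x) = (fun x => `|phi x|).
    by apply/funext => x; rewrite /psi mulrC divfK// gt_eqF.
  apply: leeD; last first.
    rewrite lee_fin le_eqVlt; apply/orP; left; apply/eqP; apply: eq_fsbigr => x _.
    by rewrite normr_id.
  rewrite lee_pmul2l ?lte_fin ?invr_gt0//.
  apply: le_esum => z _; rewrite lee_fin ler_wpM2l ?(graph_ge0 b_graph)//.
  by apply: le_powR => //; [exact: ltW|exact: ler_dist_dist].
have := le_lt_trans Ele phiE; rewrite Een lte_fin => lt0.
have Sge : - (e / 2 * psi o `^ p) <= S.
  pose T x := - (m x * W x * `|v x * psi x| `^ p).
  have TE : usum T = - (e / 2 * psi o `^ p).
    have To x : T x != 0 -> x = o.
      by rewrite /T /W; case: (eqVneq x o) => [->//|_]; rewrite mulr0 mul0r oppr0 eqxx.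
    rewrite -finite_support_usum; last first.
      by apply: sub_finite_set (finite_set1 o) => x /=; exact: To.
    have -> : \sum_(x \in [set: X]) T x = \sum_(x \in [set o]) T x.
      apply/esym/fsbig_widen => // x [_ /=] xo; apply: contrapT => /eqP /To.
      exact: xo.
    rewrite fsbig_set1 /T /W eqxx normrM powRM// !ger0_norm//.
    have := mvo; set a := m o; set c := v o `^ p => ac0.
    have [a0 c0] : a != 0 /\ c != 0.
      by move: ac0; rewrite lt0r mulf_eq0 negb_or => /andP[/andP[]].
    by field; rewrite a0 c0.
  rewrite -TE; apply: le_usum.
  - apply: finite_support_abs_summable; apply: sub_finite_set psic => x /=.
    apply: contra => /eqP psix; rewrite /T psix mulr0 normr0 powR0// mulr0 oppr0//.
  - apply: finite_support_abs_summable; apply: sub_finite_set psic => x /=.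
    by apply: contra => /eqP psix; rewrite psix powR0// !mulr0.
  - move=> x; have -> : schrodinger p b m (fun x => V x - W x) v x =
       schrodinger p b m V v x - W x * signed_pow (v x) (p - 1).
      by rewrite /schrodinger; ring.
    rewrite /T normrM powRM// (ger0_norm (psi0 x)) -mulr_signed_pow//.
    have := mulr_ge0 (mulr_ge0 (ltW (m_gt0 x)) (vsup x))
      (mulr_ge0 (v0' x) (powR_ge0 (psi x) p)).
    lra.
have pic0 := usum_ge0 (fun z => picone_edge_ge0 z v0 psi0).
(* If psi(o) = 0, the weight is not felt and the negative energy would be a sum of nonnegative
   terms. *)
have po : 0 < psi o.
  rewrite lt_neqAle psi0 andbT eq_sym; apply/eqP => po.
  by move: Sge; rewrite po powR0// mulr0 oppr0; lra.
exists (fun x => (psi o)^-1 * psi x).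
have scal : picone_edge v (fun x => (psi o)^-1 * psi x) =
    fun z => (psi o)^-1 `^ p * picone_edge v psi z.
  by apply/funext => z; rewrite picone_edgeM// invr_ge0.
have kp : 0 < (psi o)^-1 `^ p by rewrite powR_gt0// invr_gt0.
split.
- apply: sub_finite_set psic => x /=; apply: contra => /eqP ->.
  by rewrite mulr0.
- by move=> x; rewrite mulr_ge0// invr_ge0.
- by rewrite mulVf// gt_eqF.
- by rewrite scal; exact: abs_summableZ.
- have -> : e = (psi o)^-1 `^ p * (e * psi o `^ p).
    by rewrite mulrCA -powRM ?invr_ge0// mulVf ?gt_eqF// powR1 mulr1.
  by rewrite scal usumZ// ler_pM2l//; lra.
Qed.

End Energy.

(** * The Liouville comparison principle *)

Section Liouville.
Import numFieldNormedType.Exports.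
Variables (R : realType) (X : countType) (p : R).
Hypothesis p_gt1 : 1 < p.

Let p_gt0 : 0 < p. Proof. exact: lt_trans p_gt1. Qed.
Let q_gt0 : 0 < p - 1. Proof. by rewrite subr_gt0. Qed.

(** Convergence at one endpoint of an edge supplies the bound [l + 1] that [picone_coercive] asks
    there, and the vanishing remainder forces the same limit at the other; paths from [o] reach
    every vertex. *)
Lemma picone_propagation (b : X -> X -> R) (g : X -> R) (psi : nat -> X -> R) (o : X) (l : R) :
  connected_graph b -> strictly_positive_fun g -> (forall n x, 0 <= psi n x) ->
  (forall x y, b x y * picone p (g x) (g y) (psi n x) (psi n y) @[n --> \oo] --> 0) ->
  psi n o @[n --> \oo] --> l -> forall x, psi n x @[n --> \oo] --> l.
Proof.
move=> bconn g0 psi0 pic0 psio.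
suff step x y : 0 < b x y -> psi n x @[n --> \oo] --> l -> psi n y @[n --> \oo] --> l.
  move=> x; have [s sp <-] := bconn o x.
  elim: s o psio sp => //= z s ih w psiw /andP[bwz sp].
  exact: ih (step _ _ bwz psiw) sp.
move=> bxy psix.
have l0 : 0 <= l.
  by apply: (cvgr_to_ge psix); apply: nearW => n.
suff diff : psi n y - psi n x @[n --> \oo] --> 0.
  have -> : (fun n => psi n y) = (fun n => (psi n y - psi n x) + psi n x).
    by apply/funext => n; rewrite subrK.
  by rewrite -[l]add0r; exact: cvgD.
apply/cvgr0Pnorm_lt => e e0.
have l1 : 0 <= l + 1 by rewrite addr_ge0.
have [d d0 hd] := picone_coercive p_gt1 (g0 x) (g0 y) l1 e0.
have h1 : \forall n \near \oo, psi n x < l + 1.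
  by apply: (cvgr_lt _ psix); rewrite ltrDl.
have h2 : \forall n \near \oo, b x y * picone p (g x) (g y) (psi n x) (psi n y) < b x y * d.
  by apply: (cvgr_lt _ (pic0 x y)); rewrite mulr_gt0.
near=> n; rewrite distrC; apply: hd => //.
  by rewrite psi0 ltW//; near: n.
by rewrite -(ltr_pM2l bxy); near: n.
Unshelve. all: by end_near. Qed.

(** Taking the positive part contracts increments. Where u > 0 it keeps the value and does not lower
    the neighbours; where u <= 0 all its increments are nonpositive and the potential term
    vanishes. *)
Lemma positive_part_subharmonic (b : X -> X -> R) (m V u : X -> R) :
  is_graph b -> strictly_positive_fun m -> schrodinger_harmonic p b m V u ->
  formal_domain p b u^\+ /\ forall x, schrodinger p b m V u^\+ x <= 0.
Proof.
move=> bg m0 [ud uh].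
have ux x : 0 < u x -> u^\+ x = u x by move=> /ltW ux; rewrite /funrpos max_l.
have ux0 x : u x <= 0 -> u^\+ x = 0 by move=> ux0; rewrite /funrpos max_r.
have u_le x : u x <= u^\+ x by rewrite /funrpos le_max lexx.
have Ud : formal_domain p b u^\+.
  apply: formal_domain_le ud => // x y.
  rewrite /funrpos; case: (leP (u x) 0) => hx; case: (leP (u y) 0) => hy.
  - by rewrite subrr normr0.
  - rewrite sub0r normrN gtr0_norm// distrC; apply: le_trans (ler_norm _).
    by rewrite lerDl oppr_ge0.
  - by rewrite subr0 gtr0_norm//; apply: le_trans (ler_norm _); rewrite lerDl oppr_ge0.
  - by [].
split => // x; rewrite /schrodinger /p_laplacian.
have [hx|hx] := leP (u x) 0.
  rewrite ux0// signed_pow0 mulr0 addr0 pmulr_rle0 ?invr_gt0//.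
  rewrite -oppr_ge0 -usumN; apply: usum_ge0 => y.
  rewrite -mulrN mulr_ge0 ?(graph_ge0 bg)// oppr_ge0 signed_pow_le0// sub0r oppr_le0//.
have Us := formal_domain_abs_summable p_gt1 bg x Ud; rewrite (ux x hx) in Us.
rewrite -(uh x) /schrodinger /p_laplacian (ux x hx) lerD2r.
have /ler_wpM2l : 0 <= (m x)^-1 by rewrite invr_ge0 ltW.
have us := formal_domain_abs_summable p_gt1 bg x ud.
apply; apply: (le_usum Us us).
move=> y; rewrite ler_wpM2l ?(graph_ge0 bg)//; apply: le_signed_pow => //.
by rewrite lerD2l lerN2.
Qed.

Lemma picone_zero_right (u f1 f2 : R) : 0 <= u -> 0 <= f1 ->
  picone p u 0 f1 f2 = 0.
Proof.
move=> u0 f0; rewrite /picone !mul0r !subr0 normrM powRM// mulrA.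
by rewrite (mulrC (signed_pow _ _)) mulr_signed_pow// (ger0_norm f0) subrr.
Qed.

Lemma squeeze_harmonic (f : nat -> R) (C : R) :
  (forall n, 0 <= f n <= C * n.+1%:R^-1) -> f n @[n --> \oo] --> 0.
Proof.
move=> hf; apply: (@squeeze_cvgr _ _ _ _ (cst 0) (fun n => C * n.+1%:R^-1)).
- by apply: nearW.
- exact: cvg_cst.
- by rewrite -[X in _ --> X](mulr0 C); apply: cvgMr; exact: cvg_harmonic.
Qed.

(* The null family of the critical operator, transplanted to the subharmonic
   function g, is also a null family for f; its Picone remainder relative to f
   forces g / f to be constant. *)
Lemma liouville_comparison (b b' : X -> X -> R) (m V V' f g v : X -> R) (K : R) :
  is_graph b -> connected_graph b -> is_graph b' -> connected_graph b' ->
  strictly_positive_fun m ->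
  critical p b' m V' -> schrodinger_superharmonic p b' m V' v ->
  strictly_positive_fun v ->
  schrodinger_superharmonic p b m V f -> strictly_positive_fun f ->
  formal_domain p b g -> (forall x, schrodinger p b m V g x <= 0) ->
  (forall x, 0 <= g x) -> 0 <= K ->
  (forall psi, (forall x, 0 <= psi x) -> forall z : X * X,
    picone_edge p b g psi z <= K * picone_edge p b' v psi z) ->
  forall x y, g x / f x = g y / f y.
Proof.
move=> bg bconn b'g b'conn m0 crit vsup v0 [fd fsup] f0 gd gsub g0 K0 hK.
move=> x o.
have np (n : nat) : 0 < n.+1%:R^-1 :> R by rewrite invr_gt0.
have /choice[psi hpsi] (n : nat) := critical_null_family p_gt1 b'g m0 o crit vsup v0 (np n).
have psic n : c_c (psi n) by case: (hpsi n).
have psi0 n z : 0 <= psi n z by case: (hpsi n).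
have psio n : psi n o = 1 by case: (hpsi n).
have pvs n : abs_summable (picone_edge p b' v (psi n)) by case: (hpsi n).
have pvle n : usum (picone_edge p b' v (psi n)) <= n.+1%:R^-1 by case: (hpsi n).
have pv0 n z : 0 <= picone_edge p b' v (psi n) z by exact: picone_edge_ge0.
have psi1 : forall z, psi n z @[n --> \oo] --> (1 : R).
  apply: (picone_propagation b'conn v0 psi0 _ (o := o)).
    move=> z w; apply: (@squeeze_harmonic _ 1) => n; rewrite mul1r.
    rewrite (pv0 n (z, w))/=; apply: le_trans (pvle n).
    exact: (le_usum_term (z, w) (pv0 n) (pvs n)).
  by under eq_fun do rewrite psio; exact: cvg_cst.
(* Chosen so that f eta = g psi, one test function for both representations. *)
pose eta n z := g z * psi n z / f z.
have eta0 n z : 0 <= eta n z by rewrite divr_ge0 ?mulr_ge0// ltW.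
have etac n : c_c (eta n).
  apply: sub_finite_set (psic n) => z /=; apply: contra => /eqP psiz.
  by rewrite /eta psiz mulr0 mul0r.
have pf0 n z : 0 <= picone_edge p b f (eta n) z by exact: picone_edge_ge0.
have pf n : abs_summable (picone_edge p b f (eta n)) /\
    usum (picone_edge p b f (eta n)) <= K * n.+1%:R^-1.
  have [pfs _] := energy_picone p_gt1 bg m0 V fd (fun z => ltW (f0 z)) (etac n) (eta0 n).
  have [pgs _] := energy_picone p_gt1 bg m0 V gd g0 (psic n) (psi0 n).
  split; first exact: pfs.
  apply: (le_trans (usum_picone_edge_le p_gt1 bg m0 (conj fd fsup)
    (fun z => ltW (f0 z)) gd gsub g0 (etac n) (eta0 n) (psic n) (psi0 n) _)).
    by move=> z; rewrite /eta mulrC divfK// gt_eqF.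
  apply: (le_trans (le_usum pgs (abs_summableZ K (pvs n)) (hK _ (psi0 n)))).
  rewrite (usumZ K (pvs n)); exact: ler_wpM2l K0 _ _ (pvle n).
clear fsup gsub.
have etax z : eta n z @[n --> \oo] --> g z / f z.
  have -> : (fun n => eta n z) = (fun n => g z / f z * psi n z).
    by apply/funext => n; rewrite /eta mulrAC.
  by rewrite -[X in _ --> X](mulr1 (g z / f z)); apply: cvgMr; exact: psi1.
(* A second limit of the same sequence, now carried from [o] along paths by the vanishing
   remainders. *)
have etal : eta n x @[n --> \oo] --> g o / f o.
  apply: (picone_propagation bconn f0 eta0 _ (etax o)).
  move=> z w; apply: (@squeeze_harmonic _ K) => n.
  rewrite (pf0 n (z, w))/=; have [pfs pfle] := pf n; apply: le_trans pfle.
  exact: (le_usum_term (z, w) (pf0 n) pfs).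
exact: cvg_unique (etax x) etal.
Qed.

End Liouville.

Theorem theorem3p1 (R : realType) (X : countType)
  (X_infinite : infinite_set [set: X])
  (p : R) (p_gt1 : 1 < p)
  (m : X -> R) (m_gt0 : strictly_positive_fun m)
  (b : X -> X -> R) (b_graph : is_graph b) (b_conn : connected_graph b)
  (V : X -> R) (V_le1 : forall x, V x <= 1)
  (H_pos : positive_operator p b m V)
  (b' : X -> X -> R) (b'_graph : is_graph b') (b'_conn : connected_graph b')
  (V' : X -> R) (H'_crit : critical p b' m V')
  (v : X -> R) (v_ground : agmon_ground_state p b' m V' v)
  (v_gt0 : strictly_positive_fun v)
  (o : X) (G1 : X -> R) (G1_green : minimal_green p b m 1 o G1)
  (u : X -> R) (u_harm : schrodinger_harmonic p b m V u) (u_pos : u^\+ <> cst 0)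
  (C : R) (C_gt0 : 0 < C)
  (bound1 : forall x y : X, 0 < u x -> 0 < u y ->
     b x y `^ (2 / p) * (u^\+ x * u^\+ y) <=
     C * (b' x y `^ (2 / p) * (v x * v y)))
  (bound2 : forall x y : X, 0 < u x -> 0 < u y ->
     (ext_pow (b x y) (1 - 2 / p)%R *
        ext_pow `|u^\+ x - u^\+ y|%R (p - 2)%R <=
      C%:E * (ext_pow (b' x y) (1 - 2 / p)%R *
        ext_pow `|v x - v y|%R (p - 2)%R))%E)
  (u_liminf : liminf_infty (fun x => u^\+ x / G1 x) = 0%E) :
  u = cst 0.
Proof.
have [f fpos fsup] := H_pos.
have f0 := superharmonic_gt0 p_gt1 b_graph m_gt0 b_conn fpos fsup.
have [_ vsup _] := v_ground.
have [Ud Usub] := positive_part_subharmonic p_gt1 b_graph m_gt0 u_harm.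
have U0 x : 0 <= u^\+ x by rewrite /funrpos le_max lexx orbT.
have Upos x : 0 < u^\+ x -> 0 < u x by rewrite /funrpos lt_max ltxx orbF.
have [K K0 hK] := picone_compare p_gt1 C_gt0.
have edge psi : (forall x, 0 <= psi x) -> forall z : X * X,
    picone_edge p b u^\+ psi z <= K * picone_edge p b' v psi z.
  move=> psi0 [x y]; rewrite /picone_edge /=.
  (* This settles edges with an endpoint where u_+ vanishes, for there the left side is 0. *)
  have rhs0 : 0 <= K * (b' x y * picone p (v x) (v y) (psi x) (psi y)).
    rewrite mulr_ge0 ?(ltW K0)// mulr_ge0 ?(graph_ge0 b'_graph)//.
    exact: picone_ge0.
  have [ux|ux] := eqVneq (u^\+ x) 0.
    by rewrite ux piconeC picone_zero_right// mulr0.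
  have [uy|uy] := eqVneq (u^\+ y) 0.
    by rewrite uy picone_zero_right// mulr0.
  have ux0 : 0 < u^\+ x by rewrite lt0r ux U0.
  have uy0 : 0 < u^\+ y by rewrite lt0r uy U0.
  apply: hK => //; try exact: graph_ge0.
    exact: bound1 (Upos _ ux0) (Upos _ uy0).
  exact: bound2 (Upos _ ux0) (Upos _ uy0).
have ratio := liouville_comparison p_gt1 b_graph b_conn b'_graph b'_conn m_gt0
  H'_crit vsup v_gt0 fsup f0 Ud Usub U0 (ltW K0) edge.
have [x0 ux0] : exists x0, u^\+ x0 != 0.
  apply: contrapT => hn; apply: u_pos; apply/funext => x.
  by apply/eqP; apply: contrapT => /negP ux; apply: hn; exists x.
have u0 x : 0 < u x.
  apply: Upos; rewrite lt0r U0 andbT; apply/eqP => ux.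
  have := ratio x x0; rewrite ux mul0r => /esym/eqP.
  by rewrite mulf_eq0 invr_eq0 (negPf ux0) (gt_eqF (f0 x0)).
have [ud uh] := u_harm.
have u1sup x : 0 <= schrodinger p b m (cst 1) u x.
  have -> : schrodinger p b m (cst 1) u x =
      schrodinger p b m V u x + (1 - V x) * signed_pow (u x) (p - 1).
    by rewrite /schrodinger /=; move: (p_laplacian _ _ _ _ _) => L; ring.
  by rewrite uh add0r mulr_ge0 ?subr_ge0// signed_pow_ge0// ltW.
have [s s0 Gs] := minimal_green_le p_gt1 b_graph m_gt0 G1_green ud u0 u1sup.
have [[G1pos G1d G1E] _] := G1_green.
(* The source of [G1] is nonnegative, so [G1] is superharmonic for the potential 1 and may be
   divided by. *)
have G10 : strictly_positive_fun G1.
  apply: (superharmonic_gt0 p_gt1 b_graph m_gt0 b_conn G1pos (V := cst 1)).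
  by split => // x; rewrite G1E indicE.
have s_gt0 : 0 < s.
  rewrite lt0r s0 andbT; apply/eqP => sE.
  by have := lt_le_trans (G10 o) (Gs o); rewrite sE mul0r ltxx.
suff : (s^-1%:E <= liminf_infty (fun x => u^\+ x / G1 x)%R)%E.
  by rewrite u_liminf lee_fin leNgt invr_gt0 s_gt0.
(* The bound G1 <= s u holds on all of [X], so the empty exceptional set already bounds the lower
   limit from below. *)
apply: le_trans (ereal_sup_ubound _); last by exists set0 => //; exact: finite_set0.
apply/ereal_infP => _ [x _ <-]; rewrite lee_fin.
rewrite ler_pdivlMr// mulrC ler_pdivrMr// /funrpos max_l ?(ltW (u0 x))//.
by rewrite mulrC.
Qed.
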